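(* Let $G$ be a locally compact second countable group and $\Sigma=(M_i)_{i\ge1}$ a sofic approximation to $G$. For every compact metrizable space $Y$ with a jointly continuous action of $G$, every $G$-invariant Borel probability measure $\nu$ on $Y$, and every compatible metric $\rho\le1$ on $Y$, $$h^{\mathrm{meas,avg}}_{\Sigma,\varepsilon}(G,Y,\nu,\rho)=h^{\mathrm{meas}}_{\Sigma,\varepsilon}(G,Y,\nu,\rho)\qquad\text{for every }\varepsilon>0,$$ and consequently $$h^{\mathrm{meas,avg}}_{\Sigma}(G,Y,\nu,\rho)=h^{\mathrm{meas}}_{\Sigma}(G,Y,\nu,\rho).$$
   Context: **Local $G$-spaces and sofic approximations.** Let $e$ be the identity of $G$ and $m_G$ a fixed right Haar measure. A local left $G$-space is a locally compact second countable Hausdorff space $M$ with a continuous map $\vartheta:\mathrm{dom}(\vartheta)\to M$, written $\vartheta(g,p)=g.p$, with $\mathrm{dom}(\vartheta)\subseteq G\times M$ open, such that for every $p\in M$: (1) $(e,p)\in\mathrm{dom}(\vartheta)$ and $e.p=p$; (2) if $(g,p)\in\mathrm{dom}(\vartheta)$ then $(g^{-1},g.p)\in\mathrm{dom}(\vartheta)$ and $g^{-1}.(g.p)=p$; (3) if $(h,p),(g,h.p),(gh,p)\in\mathrm{dom}(\vartheta)$ then $(gh).p=g.(h.p)$; (4) there is an open neighborhood $V_p$ of $e$ with $V_p\times\{p\}\subseteq\mathrm{dom}(\vartheta)$ such that $g\mapsto g.p$ is a homeomorphism from $V_p$ onto an open neighborhood of $p$. A chart centered at $p$ is a homeomorphism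 $f_p$ from an open neighborhood $\mathrm{dom}(f_p)$ of $p$ onto an open neighborhood $\mathrm{rng}(f_p)$ of $e$ with $f_p(g.p)=g$ for all $g\in\mathrm{rng}(f_p)$. The canonical measure $\mathrm{vol}_M$ is the unique Radon measure on $M$ with $\mathrm{vol}_M(E)=m_G(f_p(E))$ for every chart $f_p$ and every Borel $E\subseteq\mathrm{dom}(f_p)$. For precompact open $U\subseteq G$, $M[U]$ is the set of $p\in M$ such that (i) if $g,h,gh\in U$ then $g.(h.p)=(gh).p$ with both sides defined, and (ii) $g\mapsto g.p$ is a homeomorphism from $U$ onto an open neighborhood of $p$. $M$ is a $(U,\varepsilon)$-sofic approximation if $0<\mathrm{vol}_M(M)<\infty$ and $\mathrm{vol}_M(M[U])\ge(1-\varepsilon)\mathrm{vol}_M(M)$. A sofic approximation to $G$ is a sequence $\Sigma=(M_i)_{i\ge1}$ with $M_i$ a $(U_i,\varepsilon_i)$-sofic approximation, where the $U_i$ are precompact open, $U_1\subseteq U_2\subseteq\cdots$, $\bigcup_iU_i=G$, and $\varepsilon_i\to0$. A group with a sofic approximation is called sofic; it is unimodular. **Entropies.** For a finite-volume local $G$-space $M$ put $\overline{\mathrm{vol}}_M=\mathrm{vol}_M/\mathrm{vol}_M(M)$, $M[g]=\{p\in M:(g,p)\in\mathrm{dom}(\vartheta)\}$, $\rho^M(\psi,\psi')=\int_M\rho(\psi(p),\psi'(p))\,d\overline{\mathrm{vol}}_M(p)$ for measurable $\psi,\psi':M\to Y$, and $$\Delta_{\rho,M}(g,\psi)=\int_{M[g]}\rho(\psi(g.p),g\psi(p))\,d\overline{\mathrm{vol}}_M(p)+\overline{\mathrm{vol}}_M(M\setminus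 M[g]).$$ For a precompact open neighborhood $L$ of $e$, $\delta>0$ and a weak-star neighborhood $\mathcal O$ of $\nu$ in $\mathrm{Prob}(Y)$: $\mathrm{Map}(M,Y,\rho:L,\delta,\mathcal O)$ is the set of measurable $\psi:M\to Y$ with $\Delta_{\rho,M}(g,\psi)<\delta$ for all $g\in L$ and $\psi_*\overline{\mathrm{vol}}_M\in\mathcal O$; $\mathrm{Map}_{\mathrm{avg}}(M,Y,\rho:L,\delta,\mathcal O)$ is the set of measurable $\psi:M\to Y$ with $\frac1{m_G(L)}\int_L\Delta_{\rho,M}(g,\psi)\,dm_G(g)<\delta$ and $\psi_*\overline{\mathrm{vol}}_M\in\mathcal O$. $\mathrm{Sep}_\varepsilon(E,\rho^M)$ is the maximal cardinality of a subset of $E$ whose distinct elements are at $\rho^M$-distance $>\varepsilon$ ($\mathrm{Sep}_\varepsilon(\varnothing)=0$, $\log0=-\infty$, $\log\infty=\infty$). With $V_i=\mathrm{vol}_{M_i}(M_i)$, $$h^{\mathrm{meas}}_{\Sigma,\varepsilon}(G,Y,\nu,\rho)=\inf_{\mathcal O}\inf_L\inf_{\delta>0}\limsup_{i\to\infty}\frac1{V_i}\log\mathrm{Sep}_\varepsilon\bigl(\mathrm{Map}(M_i,Y,\rho:L,\delta,\mathcal O),\rho^{M_i}\bigr),$$ $h^{\mathrm{meas}}_\Sigma(G,Y,\nu,\rho)=\lim_{\varepsilon\downarrow0}h^{\mathrm{meas}}_{\Sigma,\varepsilon}(G,Y,\nu,\rho)$, and $h^{\mathrm{meas,avg}}_{\Sigma,\varepsilon}$,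 $h^{\mathrm{meas,avg}}_\Sigma$ are defined in the same way with $\mathrm{Map}_{\mathrm{avg}}$ in place of $\mathrm{Map}$. *)

(* Defs.v *)
From HB Require Import structures.
From mathcomp Require Import all_boot all_order all_algebra.
From mathcomp Require Import all_classical all_reals all_analysis.

Set Implicit Arguments.
Unset Strict Implicit.
Unset Printing Implicit Defensive.

Import Order.TTheory GRing.Theory Num.Theory.
Import numFieldNormedType.Exports.

Local Open Scope classical_set_scope.
Local Open Scope ring_scope.

(* Measurable types are pointed in MathComp-Analysis, so the spaces that carry
   Borel measures are taken in ptopologicalType; the distinguished point plays
   no role. *)
Notation borel T := (g_sigma_algebraType (@open T)).

HB.mixin Record isTopologicalGroup G & Topological G & Group G := {
  mulg_continuous : continuous (fun x : G * G => (x.1 * x.2)%g) ;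
  invg_continuous : continuous (fun x : G => (x^-1)%g)
}.

#[short(type="topologicalGroupType")]
HB.structure Definition TopologicalGroup :=
  {G of PointedTopological G & Group G & isTopologicalGroup G}.

Definition lcsc_hausdorff (T : topologicalType) : Prop :=
  [/\ locally_compact [set: T], @second_countable T & hausdorff_space T].

Section measures.
Context {R : realType}.
Local Open Scope ereal_scope.

Definition radon (T : ptopologicalType)
    (mu : {measure set (borel T) -> \bar R}) : Prop :=
  [/\ forall K : set T, compact K -> mu K < +oo,
      forall B : set (borel T), measurable B ->
        mu B = ereal_inf [set mu U | U in [set U : set T | open U /\ B `<=` U]]
    & forall U : set T, open U ->
        mu U = ereal_sup [set mu K | K in [set K | compact K /\ K `<=` U]]].

Definition right_haar (G : topologicalGroupType)
    (m : {measure set (borel G) -> \bar R}) : Prop :=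
  [/\ radon m, m [set: G] != 0 &
      forall (g : G) (B : set (borel G)), measurable B ->
        m [set (x * g)%g | x in (B : set G)] = m B].

Definition weak_star_ev (Y : ptopologicalType) (mu : probability (borel Y) R) :
    {ptws continuousType Y R -> R} :=
  fun f => (\int[mu]_y f y)%R.

End measures.

(* Borel probability measures on Y with the weak-star topology. *)
Notation weak_star R Y := (initial_topology (@weak_star_ev R Y)).

Definition homeomorphism_on (X Y : topologicalType) (A : set X) (B : set Y)
    (f : X -> Y) : Prop :=
  [/\ set_bij A B f, {within A, continuous f} &
      exists g : Y -> X, {in A, cancel f g} /\ {within B, continuous g}].

(* lact is only meaningful on ldom: its values outside of ldom are junk. *)
Record localGSpace (G : topologicalGroupType) : Type := LocalGSpace {
  lcarrier :> ptopologicalType ;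
  lcarrier_lcsc : lcsc_hausdorff lcarrier ;
  ldom : set (G * lcarrier) ;
  lact : G -> lcarrier -> lcarrier ;
  ldom_open : open ldom ;
  lact_continuous :
    {within ldom, continuous (fun x : G * lcarrier => lact x.1 x.2)} ;
  lact1 : forall p, ldom (1%g, p) /\ lact 1%g p = p ;
  lactV : forall g p, ldom (g, p) ->
    ldom ((g^-1)%g, lact g p) /\ lact (g^-1)%g (lact g p) = p ;
  lactM : forall g h p,
    ldom (h, p) -> ldom (g, lact h p) -> ldom ((g * h)%g, p) ->
    lact (g * h)%g p = lact g (lact h p) ;
  lact_local_homeo : forall p, exists (V : set G) (W : set lcarrier),
    [/\ open_nbhs 1%g V, V `*` [set p] `<=` ldom, open_nbhs p W &
        homeomorphism_on V W (lact^~ p)]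
}.
Arguments ldom {G} l.
Arguments lact {G} l.

Section local_spaces.
Context {R : realType} {G : topologicalGroupType}.
Implicit Type M : localGSpace G.
Local Open Scope ereal_scope.

(* f, restricted to D, is a chart centered at p with domain D and range V. *)
Definition chart M (p : M) (D : set M) (V : set G) (f : M -> G) : Prop :=
  [/\ open_nbhs p D, open_nbhs 1%g V, homeomorphism_on D V f &
      forall g, V g -> [/\ ldom M (g, p), D (lact M g p) & f (lact M g p) = g]].

Definition canonical_measure (m : {measure set (borel G) -> \bar R}) M
    (vol : {measure set (borel M) -> \bar R}) : Prop :=
  radon vol /\
  forall (p : M) (D : set M) (V : set G) (f : M -> G), chart p D V f ->
    forall E : set (borel M), measurable E -> E `<=` D ->
      vol E = m (f @` (E : set M)).

(* M[U] *)
Definition good_points M (U : set G) : set M :=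
  [set p | (forall g h, U g -> U h -> U (g * h)%g ->
              [/\ ldom M (h, p), ldom M (g, lact M h p), ldom M ((g * h)%g, p) &
                  lact M g (lact M h p) = lact M (g * h)%g p]) /\
           U `*` [set p] `<=` ldom M /\
           exists W : set M, open_nbhs p W /\ homeomorphism_on U W ((lact M)^~ p)].
Arguments good_points : clear implicits.

Definition sofic_approx_at M (vol : {measure set (borel M) -> \bar R})
    (U : set G) (eps : R) : Prop :=
  0 < vol [set: M] < +oo /\
  (1 - eps)%:E * vol [set: M] <= vol (good_points M U).

Definition sofic_approximation (M : nat -> localGSpace G)
    (vol : forall i, {measure set (borel (M i)) -> \bar R}) : Prop :=
  exists (U : nat -> set G) (eps : nat -> R),
    [/\ forall i, open (U i) /\ precompact (U i),
        forall i, U i `<=` U i.+1,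
        \bigcup_i U i = [set: G],
        eps @ \oo --> (0 : R)%R &
        forall i, sofic_approx_at (vol i) (U i) (eps i)].

(* The normalized measure; mnormalize falls back on its default argument only
   when the total mass is 0 or infinite. *)
Definition nvol M (vol : {measure set (borel M) -> \bar R}) :
    probability (borel M) R :=
  mnormalize vol point.

(* M[g] *)
Definition dom_at M (g : G) : set M := [set p | ldom M (g, p)].

End local_spaces.
Arguments good_points {G} M U.
Arguments dom_at {G} M g.

Section systems.
Context {R : realType}.

Definition compatible_metric (Y : topologicalType) (rho : Y -> Y -> R) : Prop :=
  [/\ forall x y, 0 <= rho x y,
      forall x y, rho x y = 0 <-> x = y,
      forall x y, rho x y = rho y x,
      forall x y z, rho x z <= rho x y + rho y z &
      forall (x : Y) (A : set Y), nbhs x A <->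
        exists e : R, 0 < e /\ [set y | rho x y < e] `<=` A].

Definition continuous_action (G : topologicalGroupType) (Y : topologicalType)
    (a : G -> Y -> Y) : Prop :=
  [/\ forall y, a 1%g y = y,
      forall g h y, a (g * h)%g y = a g (a h y) &
      continuous (fun x : G * Y => a x.1 x.2)].

Definition invariant_measure (G : topologicalGroupType) (Y : ptopologicalType)
    (a : G -> Y -> Y) (nu : probability (borel Y) R) : Prop :=
  forall (g : G) (B : set (borel Y)), measurable B -> nu (a g @^-1` B) = nu B.

(* Unbounded finite cardinalities give +oo. *)
Definition Sep (T : Type) (eps : R) (E : set T) (d : T -> T -> \bar R) : \bar R :=
  ereal_sup [set (n%:R)%:E | n in
    [set n : nat | exists A : set T, [/\ A `<=` E, (A #= `I_n)%card &
      forall x y, A x -> A y -> x <> y -> (eps%:E < d x y)%E]]].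

End systems.

Section entropies.
Context {R : realType} {G : topologicalGroupType}.
Variable m : {measure set (borel G) -> \bar R}.
Variable Y : ptopologicalType.
Variable a : G -> Y -> Y.
Variable rho : Y -> Y -> R.
Local Open Scope ereal_scope.

Section one_space.
Variables (M : localGSpace G) (vol : {measure set (borel M) -> \bar R}).

Definition rhoM (psi psi' : {mfun borel M >-> borel Y}) : \bar R :=
  \int[nvol vol]_p (rho (psi p) (psi' p))%:E.

Definition Delta (g : G) (psi : {mfun borel M >-> borel Y}) : \bar R :=
  \int[nvol vol]_(p in dom_at M g)
     (rho (psi (lact M g p)) (a g (psi p)))%:E
  + nvol vol (~` dom_at M g).

Definition Map (L : set G) (delta : R) (O : set (weak_star R Y)) :
    set {mfun borel M >-> borel Y} :=
  [set psi | (forall g, L g -> Delta g psi < delta%:E) /\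
             O (distribution (nvol vol) psi)].

Definition Map_avg (L : set G) (delta : R) (O : set (weak_star R Y)) :
    set {mfun borel M >-> borel Y} :=
  [set psi | ((fine (m L))^-1)%:E * \int[m]_(g in L) Delta g psi < delta%:E /\
             O (distribution (nvol vol) psi)].

End one_space.

Variables (M : nat -> localGSpace G)
  (vol : forall i, {measure set (borel (M i)) -> \bar R}).
Variable nu : probability (borel Y) R.

Definition unit_nbhs : set (set G) :=
  [set L | open_nbhs 1%g L /\ precompact L].

Definition h_meas_eps (eps : R) : \bar R :=
  ereal_inf [set
    ereal_inf [set
      ereal_inf [set
        limn_esup (fun i => ((fine (vol i [set: M i]))^-1)%:E *
          lne (Sep eps (Map (vol i) L delta O) (rhoM (vol i))))
      | delta in [set delta : R | (0 < delta)%R]]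
    | L in unit_nbhs]
  | O in nbhs (nu : weak_star R Y)].

Definition h_meas_avg_eps (eps : R) : \bar R :=
  ereal_inf [set
    ereal_inf [set
      ereal_inf [set
        limn_esup (fun i => ((fine (vol i [set: M i]))^-1)%:E *
          lne (Sep eps (Map_avg (vol i) L delta O) (rhoM (vol i))))
      | delta in [set delta : R | (0 < delta)%R]]
    | L in unit_nbhs]
  | O in nbhs (nu : weak_star R Y)].

Definition h_meas : \bar R := lim (h_meas_eps eps @[eps --> (0 : R)%R^'+]).

Definition h_meas_avg : \bar R :=
  lim (h_meas_avg_eps eps @[eps --> (0 : R)%R^'+]).

End entropies.

(* Main.v *)
Require Import Defs.
From mathcomp Require Import all_boot all_order all_algebra.
From mathcomp Require Import all_classical all_reals all_analysis.
From mathcomp Require Import measurable_realfun ring lra.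
Set Implicit Arguments.
Unset Strict Implicit.
Unset Printing Implicit Defensive.
Import Order.TTheory GRing.Theory Num.Theory.
Import numFieldNormedType.Exports.
Local Open Scope classical_set_scope.
Local Open Scope ring_scope.

(** If [Delta g psi] is small on average over [g] in [L L], then by Markov it is
    small for all [g] in [L L] outside of a set of small Haar measure.  Given [g]
    in [L], right invariance of the Haar measure provides [h] in [L] such that
    both [h] and [h g] lie outside of that set; as [g = h^-1 (h g)] and the
    elements of [L] act equicontinuously on [Y], [Delta g psi] is small as well.
    Comparing [psi (h.(g.p))] with [h (psi (g.p))] for most [p] requires that
    [p |-> g.p] does not shrink large sets of good points to small ones, that is,
    unimodularity of [G].  This is obtained by double counting the pairs
    [(q, k.q)] with [k] in [K] and [q] a good point of [M i]: counted by [q] their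
    measure is at least about [m K * vol M], counted by [k.q] it is at most
    [m K^-1 * vol M].  Hence [m K <= m K^-1], so [m] is inversion invariant, and
    therefore left invariant. *)

(** * Sigma-compact and Borel sets *)

Lemma second_countable_seq (T : topologicalType) :
  @second_countable T -> exists b : nat -> set T,
    (forall n, open (b n)) /\
    (forall x V, nbhs x V -> exists2 n, b n x & b n `<=` V).
Proof.
case=> B cB [Bo Bn]; have [B0|[f]] := pfcard_geP cB.
  (* If the base is empty, the space has no points, so the constant empty sequence serves. *)
  exists (fun=> set0); split=> [n|x V /Bn[U [+ _] _]]; first exact: open0.
  by rewrite B0.
exists f; split=> [n|x V /Bn[U [BU Ux] UV]]; first by apply: Bo; exact: funS.
by have [n _ fn] := @surj _ _ _ _ f _ BU; exists n; rewrite fn.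
Qed.

(** Images of Borel sets need not be Borel, whereas this class is stable under continuous images and
    consists of Borel sets in Hausdorff spaces. It thus gives the measurability of sets defined by
    existential quantifiers over group elements. *)
Definition sigma_compact (T : topologicalType) (A : set T) :=
  exists K : nat -> set T, (forall n, compact (K n)) /\ A = \bigcup_n K n.

Section sigma_compact.
Context {T : topologicalType}.

(** By regularity of a compact neighbourhood, each point of [A] lies in a basic open set whose
    closure is compact and contained in [A]. There are only countably many such closures. *)
Lemma sigma_compact_open (A : set T) : lcsc_hausdorff T -> open A -> sigma_compact A.
Proof.
move=> [lT /second_countable_seq[b [bo bn]] hT] oA.
exists (fun n => if `[< compact (closure (b n)) /\ closure (b n) `<=` A >]
  then closure (b n) else set0); split.
  by move=> n; case: asboolP => [[]//|_]; exact: compact0.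
apply/seteqP; split=> x; last first.
  by case=> n _ /=; case: asboolP => [[_ sA] /sA|].
move=> Ax; have [V xV [cV clV]] := lT x I.
have {}xV : nbhs x V by move: xV; rewrite /within /=; apply: filterS => y; exact.
have [W xW WAV] : filter_from (nbhs x) closure (A `&` V).
  apply: (compact_regular hT cV xV) => //.
  by apply: filterI => //; exact: open_nbhs_nbhs.
have [n bx bW] := bn _ _ xW.
have sb : closure (b n) `<=` A `&` V.
  by apply: subset_trans WAV; exact: closureS.
exists n => //=; case: asboolP => [_|[]]; first exact: subset_closure.
split; last by move=> y /sb[].
by apply: (subclosed_compact _ cV) => [|y /sb[]//]; exact: closed_closure.
Qed.

Lemma sigma_compact_closedI (A C : set T) : sigma_compact A -> closed C -> sigma_compact (A `&` C).
Proof.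
move=> [K [cK ->]] cC; exists (fun n => K n `&` C); split.
  by move=> n; exact: compact_closedI.
by rewrite setI_bigcupl.
Qed.

Lemma sigma_compact_image (U : topologicalType) (f : T -> U) (A : set T) :
  continuous f -> sigma_compact A -> sigma_compact (f @` A).
Proof.
move=> cf [K [cK ->]]; exists (fun n => f @` K n); split.
  by move=> n; apply: continuous_compact => //; exact: continuous_subspaceT.
by rewrite image_bigcup.
Qed.

Lemma sigma_compact_locally_closed (A O O' : set T) : lcsc_hausdorff T ->
  open O -> open O' -> A = O `\` O' -> sigma_compact A.
Proof.
move=> hT oO oO' ->; rewrite setDE; apply: sigma_compact_closedI.
  exact: sigma_compact_open.
exact: open_closedC.
Qed.

End sigma_compact.

(** * Products of locally compact second countable Hausdorff spaces *)

Lemma hausdorff_prod (S T : topologicalType) :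
  hausdorff_space S -> hausdorff_space T -> hausdorff_space (S * T)%type.
Proof.
move=> hS hT [p1 p2] [q1 q2] pq; congr pair.
  apply: hS => A B Ap Bq.
  have [||[x1 x2] [/= Ax Bx]] := pq (A `*` setT) (B `*` setT).
  - by exists (A, setT) => //=; split => //; exact: filterT.
  - by exists (B, setT) => //=; split => //; exact: filterT.
  - by exists x1; case: Ax; case: Bx.
apply: hT => A B Ap Bq.
have [||[x1 x2] [/= Ax Bx]] := pq (setT `*` A) (setT `*` B).
- by exists (setT, A) => //=; split => //; exact: filterT.
- by exists (setT, B) => //=; split => //; exact: filterT.
- by exists x2; case: Ax; case: Bx.
Qed.

Lemma open_setX (S T : topologicalType) (A : set S) (B : set T) :
  open A -> open B -> open (A `*` B).
Proof.
rewrite !openE => oA oB [x y] [/= /oA Ax /oB By].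
by exists (A, B).
Qed.

Lemma open_prod_rectangles (S T : topologicalType) (A : set (S * T)) :
  @second_countable S -> @second_countable T -> open A ->
  exists (B : nat -> set S) (C : nat -> set T),
    [/\ forall n, open (B n), forall n, open (C n) &
        A = \bigcup_i \bigcup_(j in [set j | B i `*` C j `<=` A]) (B i `*` C j)].
Proof.
move=> /second_countable_seq[b [bo bn]] /second_countable_seq[c [co cn]] oA.
exists b, c; split=> //; apply/seteqP; split=> [[x y] Axy|xy]; last first.
  by move=> [i _] [j sA] /sA.
have [[B C] /= [Bx Cy] BCA] : nbhs (x, y) A by exact: open_nbhs_nbhs.
have [i bx bB] := bn _ _ Bx; have [j cy cC] := cn _ _ Cy.
exists i => //; exists j => //= -[u v] [/= bu cv]; apply: BCA => /=.
by split; [exact: bB|exact: cC].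
Qed.

Lemma second_countable_prod (S T : topologicalType) :
  @second_countable S -> @second_countable T -> @second_countable (S * T)%type.
Proof.
move=> /second_countable_seq[b [bo bn]] /second_countable_seq[c [co cn]].
exists (range (fun ij : nat * nat => b ij.1 `*` c ij.2)).
  exact: card_le_trans (card_image_le _ _) (countableP _).
split=> [_ [[i j] _ <-]|[x y] V [[B C] /= [Bx Cy] BCV]].
  exact: open_setX.
have [i bx bB] := bn _ _ Bx; have [j cy cC] := cn _ _ Cy.
exists (b i `*` c j); first by split => //; exists (i, j).
by move=> [u v] [/= bu cv]; apply: BCV; split; [exact: bB|exact: cC].
Qed.

Lemma locally_compact_prod (S T : topologicalType) :
  hausdorff_space S -> hausdorff_space T ->
  locally_compact [set: S] -> locally_compact [set: T] ->
  locally_compact [set: S * T].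
Proof.
move=> hS hT lS lT [x y] _.
have [V xV [cV clV]] := lS x I; have [W yW [cW clW]] := lT y I.
have {}xV : nbhs x V by move: xV; rewrite /within /=; apply: filterS => z; exact.
have {}yW : nbhs y W by move: yW; rewrite /within /=; apply: filterS => z; exact.
exists (V `*` W); first by exists (V, W) => // z ? _.
have cVW := compact_setX cV cW; split => //.
by apply: compact_closed => //; exact: hausdorff_prod.
Qed.

Lemma lcsc_hausdorff_prod (S T : topologicalType) :
  lcsc_hausdorff S -> lcsc_hausdorff T -> lcsc_hausdorff (S * T)%type.
Proof.
move=> [lS sS hS] [lT sT hT]; split.
- exact: locally_compact_prod.
- exact: second_countable_prod.
- exact: hausdorff_prod.
Qed.

(** * Borel sets and Borel maps *)

Lemma borel_open (T : ptopologicalType) (A : set T) :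
  open A -> measurable (A : set (borel T)).
Proof. by move=> oA; apply: sub_sigma_algebra. Qed.

Lemma borel_closed (T : ptopologicalType) (A : set T) :
  closed A -> measurable (A : set (borel T)).
Proof.
move=> cA; rewrite -[A]setCK; apply: measurableC; apply: borel_open.
exact: closed_openC.
Qed.

Lemma borel_sigma_compact (T : ptopologicalType) (A : set T) :
  hausdorff_space T -> sigma_compact A -> measurable (A : set (borel T)).
Proof.
move=> hT [K [cK ->]]; apply: bigcup_measurable => n _; apply: borel_closed.
exact: compact_closed.
Qed.

(** The sigma-algebra here is the product of the two Borel sigma-algebras. Second countability
    writes [A] as a countable union of open rectangles, which places it there. *)
Lemma borel_prod_open (S T : ptopologicalType) (A : set (S * T)) :
  @second_countable S -> @second_countable T -> open A ->
  measurable (A : set (borel S * borel T)).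
Proof.
move=> sS sT oA; have [B [C [oB oC ->]]] := open_prod_rectangles sS sT oA.
apply: bigcup_measurable => i _; apply: bigcup_measurable => j _.
by apply: measurableX; exact: borel_open.
Qed.

Lemma borel_prod_sigma_compact (S T : ptopologicalType) (A : set (S * T)) :
  lcsc_hausdorff S -> lcsc_hausdorff T -> sigma_compact A ->
  measurable (A : set (borel S * borel T)).
Proof.
move=> [lS sS hS] [lT sT hT] [K [cK ->]]; apply: bigcup_measurable => n _.
rewrite -[K n]setCK; apply: measurableC; apply: borel_prod_open => //.
by apply: closed_openC; apply: compact_closed => //; exact: hausdorff_prod.
Qed.

Lemma borel_measurable_fun d (X : measurableType d) (T : ptopologicalType)
    (D : set X) (f : X -> borel T) :
  (forall O : set T, open O -> measurable (D `&` f @^-1` O)) ->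
  measurable_fun D f.
Proof.
move=> h; refine (@measurability _ _ X (borel T) D f (@open T) erefl _).
by move=> _ [V oV <-]; exact: h.
Qed.

Lemma open_within_preimage (X T : topologicalType) (D : set X) (f : X -> T)
    (O : set T) :
  open D -> {within D, continuous f} -> open O -> open (D `&` f @^-1` O).
Proof.
by move=> oD; rewrite continuous_open_subspace// => /(continuous_inP _ oD); apply.
Qed.

Lemma borel_measurable_within (S T : ptopologicalType) (D : set S) (f : S -> T) :
  open D -> {within D, continuous f} ->
  measurable_fun (D : set (borel S)) (f : borel S -> borel T).
Proof.
move=> oD cf; apply: borel_measurable_fun => O oO; apply: borel_open.
exact: open_within_preimage.
Qed.

(** * Good points *)

Lemma open_offdiagonal (T : topologicalType) :
  hausdorff_space T -> open [set x : T * T | x.1 <> x.2].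
Proof.
rewrite open_hausdorff => hT; rewrite openE => -[x y] /= /eqP/hT[[A B] /= [xA yB] [oA oB]].
move=> /eqP AB0; rewrite !inE in xA yB; exists (A, B) => /=.
  by split; exact: open_nbhs_nbhs.
move=> [u v] [/= Au Bv] uv; have : (A `&` B) v by split => //; rewrite -uv.
by rewrite AB0.
Qed.

Section orbit_maps.
Context {G : topologicalGroupType} (M : localGSpace G).
Hypothesis lcscG : lcsc_hausdorff G.

Lemma cvg_mulg (T : Type) (F : set_system T) (u v : T -> G) (g h : G) :
  Filter F -> u @ F --> g -> v @ F --> h -> (fun t => (u t * v t)%g) @ F --> (g * h)%g.
Proof.
move=> FF ug vh.
apply: (@cvg_comp _ _ _ (fun t => (u t, v t)) (fun x : G * G => (x.1 * x.2)%g) F _ _).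
  exact: cvg_pair ug vh.
exact: (@mulg_continuous G (g, h)).
Qed.

Lemma near_ldom (T : Type) (F : set_system T) (u : T -> G) (v : T -> M) g p :
  Filter F -> ldom M (g, p) -> u @ F --> g -> v @ F --> p ->
  \forall t \near F, ldom M (u t, v t).
Proof.
move=> FF Dgp ug vp; have nD : nbhs (g, p) (ldom M).
  by apply: open_nbhs_nbhs; split => //; exact: ldom_open.
exact: (cvg_pair ug vp nD).
Qed.

Lemma cvg_lact (T : Type) (F : set_system T) (u : T -> G) (v : T -> M) g p :
  Filter F -> ldom M (g, p) -> u @ F --> g -> v @ F --> p ->
  (fun t => lact M (u t) (v t)) @ F --> lact M g p.
Proof.
move=> FF Dgp ug vp.
apply: (@cvg_comp _ _ _ (fun t => (u t, v t)) (fun x : G * M => lact M x.1 x.2) F _ _).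
  exact: cvg_pair ug vp.
have := @lact_continuous G M; rewrite continuous_open_subspace; last exact: ldom_open.
by move=> /(_ (g, p)); apply; rewrite inE.
Qed.

Lemma lact_within (p : M) (U : set G) :
  open U -> U `*` [set p] `<=` ldom M -> {within U, continuous ((lact M)^~ p)}.
Proof.
move=> oU UD; rewrite continuous_open_subspace// => g; rewrite inE => Ug.
by apply: cvg_lact; [exact: UD|exact: cvg_id|exact: cvg_cst].
Qed.

Lemma homeomorphism_on_open (S T : topologicalType) (A O : set S) (B : set T) f :
  homeomorphism_on A B f -> open B -> open O -> O `<=` A -> open (f @` O).
Proof.
move=> [fAB cf [g [fK cg]]] oB oO OA.
suff -> : f @` O = B `&` g @^-1` O by exact: open_within_preimage.
apply/seteqP; split=> [_ [x Ox <-]|y [By Ogy]].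
  split; first by apply: (set_bij_homo fAB); exact: OA.
  by rewrite /= fK// inE; exact: OA.
have [x Ax xy] := set_bij_surj fAB By; exists x => //.
by move: Ogy; rewrite -xy /= fK// inE.
Qed.

(** Near [u.p] the identity [(v u).p = v.(u.p)] reduces the claim to the orbit map of [u.p] near the
    identity, where it is a local homeomorphism. *)
Lemma orbit_map_open (p : M) (O : set G) :
  open O -> O `*` [set p] `<=` ldom M -> open ((lact M)^~ p @` O).
Proof.
move=> oO OD; rewrite openE => _ [u Ou <-].
have Dup : ldom M (u, p) by exact: OD.
have [V [W [[oV V1] VD [oW Wq] hVW]]] := lact_local_homeo (lact M u p).
pose V' := V `&` [set v | O (v * u)%g].
have oV' : open V'.
  apply: openI => //; apply: (@open_comp _ _ (fun v => (v * u)%g)) => //.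
  by move=> v _; apply: cvg_mulg; [exact: cvg_id|exact: cvg_cst].
have : open ((lact M)^~ (lact M u p) @` V').
  by apply: homeomorphism_on_open hVW oW oV' _ => v [].
rewrite openE => /(_ (lact M u p)) /=; rewrite /interior => h.
have {h} : nbhs (lact M u p) ((lact M)^~ (lact M u p) @` V').
  apply: h; exists 1%g; last by have [] := lact1 (lact M u p).
  by split => //=; rewrite mul1g.
apply: filterS => _ [v [Vv Ovu] <-]; exists (v * u)%g => //.
by apply: lactM => //; [exact: VD|exact: OD].
Qed.

Lemma good_points_ldom (U : set G) p g : good_points M U p -> U g -> ldom M (g, p).
Proof. by move=> [_ [UD _]] Ug; apply: UD. Qed.

Lemma good_points_mul (U : set G) p g h : good_points M U p ->
  U g -> U h -> U (g * h)%g ->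
  ldom M (g, lact M h p) /\ lact M g (lact M h p) = lact M (g * h)%g p.
Proof. by move=> [ghM _] Ug Uh /(ghM _ _ Ug Uh)[]. Qed.

Lemma good_points_inj (U : set G) p : good_points M U p ->
  {in U &, injective ((lact M)^~ p)}.
Proof. by move=> [_ [_ [W [_ [/set_bij_inj]]]]]. Qed.

(** Eliminates the homeomorphism condition: injectivity suffices, because the orbit map is
    continuous and open wherever it is defined. What remains is a list of universal conditions on
    group elements, fit for the measurability proof below. *)
Lemma good_pointsP (U : set G) p : open U -> U 1%g ->
  (forall g, U g -> ldom M (g, p)) ->
  (forall g h, U g -> U h -> U (g * h)%g -> ldom M (g, lact M h p)) ->
  (forall g h, U g -> U h -> lact M g p = lact M h p -> g = h) ->
  good_points M U p.
Proof.
move=> oU U1 UD UM Uinj; have sUD : U `*` [set p] `<=` ldom M.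
  by move=> [g q] [/= Ug ->]; exact: UD.
split; last split => //.
  move=> g h Ug Uh Ugh; have Dh := UD _ Uh; have Dgh := UD _ Ugh.
  by have Dg := UM _ _ Ug Uh Ugh; split => //; rewrite -lactM.
exists ((lact M)^~ p @` U); split.
  by split; [exact: orbit_map_open|exists 1%g => //; exact: (lact1 p).2].
have injU : {in U &, injective ((lact M)^~ p)}.
  by move=> g h; rewrite !inE; exact: Uinj.
split.
- by split.
- exact: lact_within.
exists (pinv U ((lact M)^~ p)); split; first by apply/pinvKV.
rewrite continuous_open_subspace; last exact: orbit_map_open.
apply/continuous_inP; first exact: orbit_map_open.
move=> X oX.
suff -> : (lact M)^~ p @` U `&` pinv U (lact M ^~ p) @^-1` X =
    (lact M)^~ p @` (U `&` X).
  apply: orbit_map_open; first exact: openI.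
  by move=> [g q] [[/= Ug _] ->]; exact: UD.
apply/seteqP; split=> [_ [[g Ug <-]] /=|_ [g [Ug Xg] <-]].
  by rewrite pinvKV ?inE// => Xg; exists g.
by split => /=; [exists g|rewrite pinvKV ?inE].
Qed.

(** By [good_pointsP], a point fails to be good when some group elements witness one of three
    failures. The complement is therefore a union of three projections of differences of open sets,
    each of them sigma-compact. *)
Lemma good_points_measurable (U : set G) : open U -> U 1%g ->
  measurable (good_points M U : set (borel M)).
Proof.
move=> oU U1; have lcscM := lcarrier_lcsc M.
have lGM := lcsc_hausdorff_prod lcscG lcscM.
have lGGM := lcsc_hausdorff_prod (lcsc_hausdorff_prod lcscG lcscG) lcscM.
have [_ _ hG] := lcscG; have [_ _ hM] := lcscM.
(* The failures are: [g.p] undefined ([B1]), [g.(h.p)] undefined ([O2] minus [O2']), and [g.p = h.p]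
   with [g <> h] ([O3] minus [O3']). The domain conditions inside the primed sets make these open,
   as the action is continuous only on [ldom M]. *)
pose B1 : set (G * M) := (U `*` setT) `\` ldom M.
pose O2 : set (G * G * M) := [set w | (U w.1.1 /\ U w.1.2) /\
  (U (w.1.1 * w.1.2)%g /\ ldom M (w.1.2, w.2))].
pose O2' : set (G * G * M) := [set w | ldom M (w.1.2, w.2) /\
  ldom M (w.1.1, lact M w.1.2 w.2)].
pose O3 : set (G * G * M) := [set w | (U w.1.1 /\ U w.1.2) /\
  (w.1.1 <> w.1.2 /\ (ldom M (w.1.1, w.2) /\ ldom M (w.1.2, w.2)))].
pose O3' : set (G * G * M) := [set w |
  (ldom M (w.1.1, w.2) /\ ldom M (w.1.2, w.2)) /\
  lact M w.1.1 w.2 <> lact M w.1.2 w.2].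
have cg (w : G * G * M) : (fun w : G * G * M => w.1.1) @ w --> w.1.1.
  by apply: (@cvg_comp _ _ _ fst fst); [exact: cvg_fst|exact: cvg_fst].
have ch (w : G * G * M) : (fun w : G * G * M => w.1.2) @ w --> w.1.2.
  by apply: (@cvg_comp _ _ _ fst snd); [exact: cvg_fst|exact: cvg_snd].
have cp (w : G * G * M) : (fun w : G * G * M => w.2) @ w --> w.2.
  exact: cvg_snd.
have nU (w : G * G * M) (u : G * G * M -> G) : U (u w) -> u @ w --> u w ->
    \forall x \near w, U (u x).
  move=> Uw cu; have nU : nbhs (u w) U by apply: open_nbhs_nbhs; split.
  exact: (cu _ nU).
have oO2 : open O2.
  rewrite openE => w [[Ug Uh] [Ugh Dh]].
  apply: filterI; first by apply: filterI;
    [exact: (nU _ (fun x => x.1.1))|exact: (nU _ (fun x => x.1.2))].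
  apply: filterI; last exact: (near_ldom _ Dh (ch w) (cp w)).
  apply: (nU _ (fun x => (x.1.1 * x.1.2)%g)) => //.
  exact: (cvg_mulg _ (cg w) (ch w)).
have oO2' : open O2'.
  rewrite openE => w [Dh Dg]; apply: filterI; first exact: (near_ldom _ Dh (ch w) (cp w)).
  exact: (near_ldom _ Dg (cg w) (cvg_lact _ Dh (ch w) (cp w))).
have oO3 : open O3.
  rewrite openE => w [[Ug Uh] [gh [Dg Dh]]].
  apply: filterI; first by apply: filterI;
    [exact: (nU _ (fun x => x.1.1))|exact: (nU _ (fun x => x.1.2))].
  apply: filterI.
    have nN : nbhs (w.1.1, w.1.2) [set x : G * G | x.1 <> x.2].
      by apply: open_nbhs_nbhs; split => //; exact: open_offdiagonal.
    exact: (cvg_pair (cg w) (ch w) nN).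
  by apply: filterI; [exact: (near_ldom _ Dg (cg w) (cp w))|
      exact: (near_ldom _ Dh (ch w) (cp w))].
have oO3' : open O3'.
  rewrite openE => w [[Dg Dh] gh]; apply: filterI.
    by apply: filterI; [exact: (near_ldom _ Dg (cg w) (cp w))|
      exact: (near_ldom _ Dh (ch w) (cp w))].
  have nN : nbhs (lact M w.1.1 w.2, lact M w.1.2 w.2)
      [set x : M * M | x.1 <> x.2].
    by apply: open_nbhs_nbhs; split => //; exact: open_offdiagonal.
  exact: (cvg_pair (cvg_lact _ Dg (cg w) (cp w))
    (cvg_lact _ Dh (ch w) (cp w)) nN).
have mB (S : topologicalType) (A : set (S * M)) :
    sigma_compact A -> measurable (snd @` A : set (borel M)).
  move=> kA; apply: borel_sigma_compact => //; apply: sigma_compact_image kA => w.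
  exact: cvg_snd.
have -> : good_points M U =
    ~` (snd @` B1 `|` (snd @` (O2 `\` O2') `|` snd @` (O3 `\` O3'))).
  apply/seteqP; split=> [p Up|p /not_orP[b1 /not_orP[b2 b3]]].
    move=> [[[g q] [[/= Ug _] nD]] qp|[[[[g h] q]]|[[[g h] q]]]].
    - by apply: nD; rewrite /= in qp; rewrite qp; exact: good_points_ldom Up Ug.
    - move=> [[[/= Ug Uh] [Ugh Dh]] /= nO] qp; apply: nO.
      rewrite {}qp in Dh *; split => //=.
      by have [] := good_points_mul Up Ug Uh Ugh.
    - move=> [[[/= Ug Uh] [gh [Dg Dh]]] /= nO] qp; apply: nO; split => //=.
      by rewrite qp => /(good_points_inj Up); rewrite !inE => /(_ Ug Uh).
  have UD g : U g -> ldom M (g, p).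
    by move=> Ug; apply: contrapT => nD; apply: b1; exists (g, p).
  apply: good_pointsP => // [g h Ug Uh Ugh|g h Ug Uh ghp].
    apply: contrapT => nD; apply: b2; exists ((g, h), p) => //.
    by split; [split => //; split => //; exact: UD|move=> []].
  apply: contrapT => gh; apply: b3; exists ((g, h), p) => //.
  by split; [split => //; split => //; split; exact: UD|move=> []].
apply: measurableC; apply: measurableU; last apply: measurableU; apply: mB.
- apply: (@sigma_compact_locally_closed _ _ (U `*` setT) (ldom M)) => //.
    by apply: open_setX => //; exact: openT.
  exact: ldom_open.
- exact: (@sigma_compact_locally_closed _ _ O2 O2').
- exact: (@sigma_compact_locally_closed _ _ O3 O3').
Qed.

End orbit_maps.

(** * Haar measure and volume in charts *)

Lemma precompact_image (S T : topologicalType) (f : S -> T) (A : set S) :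
  hausdorff_space T -> continuous f -> precompact A -> precompact (f @` A).
Proof.
move=> hT cf [C /= AC [cC _]]; have cfC : compact (f @` C).
  by apply: continuous_compact => //; exact: continuous_subspaceT.
exists (f @` C); first by move=> _ [x /AC Cx <-]; exists x.
by split => //; exact: compact_closed.
Qed.

Lemma precompact_setX (S T : topologicalType) (A : set S) (B : set T) :
  hausdorff_space S -> hausdorff_space T ->
  precompact A -> precompact B -> precompact (A `*` B).
Proof.
move=> hS hT [C /= AC [cC _]] [D /= BD [cD _]]; have cCD := compact_setX cC cD.
exists (C `*` D); first by move=> [x y] [/= /AC Cx /BD Dy].
by split => //; apply: compact_closed => //; exact: hausdorff_prod.
Qed.

Lemma borel_image_can (S T : ptopologicalType) (f : S -> T) (g : T -> S)
    (A : set S) :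
  cancel f g -> cancel g f -> continuous g ->
  measurable (A : set (borel S)) -> measurable (f @` A : set (borel T)).
Proof.
move=> fK gK cg mA; have -> : f @` A = setT `&` g @^-1` A.
  rewrite setTI; apply/seteqP; split=> [_ [x Ax <-] /=|y Agy]; first by rewrite fK.
  by exists (g y).
have mg : measurable_fun [set: borel T] (g : borel T -> borel S).
  by apply: borel_measurable_within; [exact: openT|exact: continuous_subspaceT].
exact: mg.
Qed.

Lemma open_image_can (S T : topologicalType) (f : S -> T) (g : T -> S)
    (A : set S) :
  cancel f g -> cancel g f -> continuous g -> open A -> open (f @` A).
Proof.
move=> fK gK cg oA; have -> : f @` A = g @^-1` A.
  apply/seteqP; split=> [_ [x Ax <-] /=|y Agy]; first by rewrite fK.
  by exists (g y).
by move/continuousP: cg; apply.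
Qed.

(** * Translations and inversion in the group *)

Section translations.
Context {G : topologicalGroupType}.

Lemma mulgr_continuous (g : G) : continuous (fun x : G => (x * g)%g).
Proof. by move=> x; apply: cvg_mulg; [exact: cvg_id|exact: cvg_cst]. Qed.

Lemma mulgl_continuous (g : G) : continuous (fun x : G => (g * x)%g).
Proof. by move=> x; apply: cvg_mulg; [exact: cvg_cst|exact: cvg_id]. Qed.

Lemma open_mulr (g : G) (A : set G) : open A -> open [set (x * g)%g | x in A].
Proof.
apply: (@open_image_can _ _ _ (fun x => x * g^-1)%g).
- by move=> x; rewrite mulgK.
- by move=> x; rewrite mulgVK.
- exact: mulgr_continuous.
Qed.

Lemma open_mull (g : G) (A : set G) : open A -> open [set (g * x)%g | x in A].
Proof.
apply: (@open_image_can _ _ _ (fun x => g^-1 * x)%g).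
- by move=> x; rewrite mulKg.
- by move=> x; rewrite mulVKg.
- exact: mulgl_continuous.
Qed.

Lemma open_invg (A : set G) : open A -> open [set (x^-1)%g | x in A].
Proof.
apply: (@open_image_can _ _ _ (fun x => x^-1)%g).
- by move=> x; rewrite invgK.
- by move=> x; rewrite invgK.
- exact: invg_continuous.
Qed.

Lemma borel_mull (g : G) (A : set G) : measurable (A : set (borel G)) ->
  measurable ([set (g * x)%g | x in A] : set (borel G)).
Proof.
apply: (@borel_image_can _ _ _ (fun x => g^-1 * x)%g).
- by move=> x; rewrite mulKg.
- by move=> x; rewrite mulVKg.
- exact: mulgl_continuous.
Qed.

End translations.

Section haar.
Context {R : realType} {G : topologicalGroupType}.
Variable m : {measure set (borel G) -> \bar R}.
Hypotheses (lcscG : lcsc_hausdorff G) (haarm : right_haar m).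
Local Open Scope ereal_scope.

Lemma haar_mulr (g : G) (B : set G) : measurable (B : set (borel G)) ->
  m [set (x * g)%g | x in B] = m B.
Proof. by have [_ _] := haarm; apply. Qed.

Lemma haar_precompact (A : set G) : measurable (A : set (borel G)) ->
  precompact A -> m A < +oo.
Proof.
move=> mA [C /= AC [cC clC]]; have [[mfin _ _] _ _] := haarm.
apply: le_lt_trans (mfin C cC); apply: le_measure; rewrite ?inE//.
exact: borel_closed.
Qed.

(** If [K] were null, so would be its right translates, which cover the group. Each point would then
    lie in a null basic open set, and as there are countably many of these, the whole group would be
    null. *)
Lemma haar_open_gt0 (K : set G) : open K -> K !=set0 -> 0 < m K.
Proof.
move=> oK [k Kk]; rewrite lt0e measure_ge0 andbT; apply/eqP => mK0.
have [_ mG _] := haarm; move/negP: mG; apply; apply/eqP.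
have [_ /second_countable_seq[b [bo bn]] _] := lcscG.
pose N n := if `[< m (b n) = 0 >] then b n else set0.
have -> : [set: G] = \bigcup_n N n.
  apply/seteqP; split => // x _.
  pose Kx := [set (y * (k^-1 * x))%g | y in K].
  have oKx : open Kx by exact: open_mulr.
  have Kxx : Kx x by exists k => //; rewrite mulVKg.
  have [n bx bK] := bn x Kx (open_nbhs_nbhs (conj oKx Kxx)).
  exists n => //; rewrite /N; case: asboolP => // -[].
  apply/eqP; rewrite eq_le measure_ge0 andbT -mK0.
  rewrite -(haar_mulr (k^-1 * x)%g (borel_open oK)).
  by apply: le_measure => //; rewrite inE; exact: borel_open.
have mN n : measurable (N n : set (borel G)).
  by rewrite /N; case: asboolP => // _; exact: borel_open.
have N0 n : m (N n) = 0 by rewrite /N; case: asboolP => // _; rewrite measure0.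
apply/eqP; rewrite eq_le measure_ge0 andbT.
have mNU : measurable (\bigcup_n N n : set (borel G)) by exact: bigcup_measurable.
apply: (le_trans (measure_sigma_subadditive m mN mNU (@subset_refl _ _))).
by rewrite eseries0.
Qed.

Variables (M : localGSpace G) (vol : {measure set (borel M) -> \bar R}).
Hypothesis volM : canonical_measure m vol.
Variable U : set G.
Hypotheses (oU : open U) (U1 : U 1%g).

(** The inverse of the orbit map of a good point, defined on the open image [W] of [U], is a chart
    centered at [p]. The canonical measure is Haar measure in this chart. *)
Lemma good_points_vol (p : M) (B : set G) : good_points M U p ->
  measurable (B : set (borel G)) -> B `<=` U ->
  measurable ((lact M)^~ p @` B : set (borel M)) /\
  vol ((lact M)^~ p @` B) = m B.
Proof.
move=> Up mB BU; have [_ [UD [W [oW hUW]]]] := Up.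
have [bUW cUW [f [fK cf]]] := hUW.
have fUE g : U g -> f (lact M g p) = g by move=> Ug; rewrite fK// inE.
have sW g : U g -> W (lact M g p) by move=> Ug; exact: (set_bij_homo bUW).
have EE : (lact M)^~ p @` B = W `&` f @^-1` B.
  apply/seteqP; split=> [_ [g Bg <-]|q [Wq Bfq]].
    by split; [exact/sW/BU|rewrite /= fUE//; exact: BU].
  have [g Ug gq] := set_bij_surj bUW Wq; exists g => //.
  by move: Bfq; rewrite -gq /= fUE.
have mE : measurable ((lact M)^~ p @` B : set (borel M)).
  rewrite EE; apply: (@borel_measurable_within _ _ W f) => //.
  - by have [] := oW.
  - by apply: borel_open; have [] := oW.
split => //.
have cU : chart p W U f.
  split => //.
    split; last first.
    - exists ((lact M)^~ p); split => // q; rewrite inE => Wq.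
      by have [g Ug gq] := set_bij_surj bUW Wq; rewrite -gq fUE.
    - exact: cf.
    split.
    - move=> q Wq; have [g Ug <-] := set_bij_surj bUW Wq.
      by rewrite fUE.
    - move=> q q'; rewrite !inE => Wq Wq'.
      have [g Ug <-] := set_bij_surj bUW Wq.
      by have [g' Ug' <-] := set_bij_surj bUW Wq'; rewrite !fUE// => ->.
    - by move=> g Ug; exists (lact M g p); [exact: sW|exact: fUE].
  move=> g Ug; split; [exact: UD|exact: sW|exact: fUE].
have [_ /(_ p W U f cU) ->] := volM.
- congr (m _); apply/seteqP; split=> [_ [_ [g Bg <-] <-]|g Bg].
    by rewrite fUE//; exact: BU.
  by exists (lact M g p); [exists g|exact/fUE/BU].
- exact: mE.
- by rewrite EE; exact: subIsetl.
Qed.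

Lemma good_points_orbit_measurable (p : M) (E : set M) : good_points M U p ->
  measurable (E : set (borel M)) ->
  measurable (U `&` (lact M)^~ p @^-1` E : set (borel G)).
Proof.
move=> [_ [UD _]] mE; apply: (borel_measurable_within oU (lact_within oU UD)) => //.
exact: borel_open.
Qed.

End haar.

(** * Unimodularity *)

Section normalized_volume.
Context {R : realType} {G : topologicalGroupType} (M : localGSpace G).
Variable vol : {measure set (borel M) -> \bar R}.
Hypothesis volT : (0 < vol [set: M] < +oo)%E.
Local Open Scope ereal_scope.

Lemma nvolE (E : set M) :
  nvol vol E = vol E * (fine (vol [set: M]))^-1%:E.
Proof.
rewrite /nvol /= /mnormalize /= ifF//.
by move/andP: volT => [v0 voo]; rewrite gt_eqF//= lt_eqF.
Qed.

Lemma fine_volT_gt0 : (0 < fine (vol [set: M]))%R.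
Proof. by rewrite fine_gt0. Qed.

End normalized_volume.

Section unimodularity.
Context {R : realType} {G : topologicalGroupType}.
Variable m : {measure set (borel G) -> \bar R}.
Hypotheses (lcscG : lcsc_hausdorff G) (haarm : right_haar m).
Local Open Scope ereal_scope.

Lemma haar_le_inv_good_points (M : localGSpace G)
    (vol : {measure set (borel M) -> \bar R}) (K U : set G) :
  canonical_measure m vol -> 0 < vol [set: M] < +oo ->
  open U -> U 1%g -> open K -> K `<=` U ->
  (forall k k', K k -> K k' -> U (k^-1 * k')%g) ->
  m K * nvol vol (good_points M U) <= m [set (k^-1)%g | k in K].
Proof.
move=> volM volT oU U1 oK KU KKU.
have v0 := fine_volT_gt0 volT.
set c := ((fine (vol [set: M]))^-1%:E); have c0 : 0 <= c.
  by rewrite lee_fin invr_ge0 ltW.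
have mU := good_points_measurable lcscG oU U1 (M := M).
have lcscM := lcarrier_lcsc M.
(* The relation [r = k.q] for some [k] in [K], to which Tonelli's theorem is applied after
   restricting [q] to good points. It is the projection of a difference of open sets, hence
   sigma-compact and measurable. *)
pose Z0 : set (M * M) := [set w | exists k,
  [/\ K k, ldom M (k, w.1) & lact M k w.1 = w.2]].
have mZ0 : measurable (Z0 : set (borel M * borel M)).
  apply: borel_prod_sigma_compact => //.
  pose O1 : set (G * M * M) := [set w | K w.1.1 /\ ldom M (w.1.1, w.1.2)].
  pose O2 : set (G * M * M) := [set w | ldom M (w.1.1, w.1.2) /\
    lact M w.1.1 w.1.2 <> w.2].
  have -> : Z0 = (fun w : G * M * M => (w.1.2, w.2)) @` (O1 `\` O2).
    apply/seteqP; split=> [[q r] [k [/= Kk Dk kq]]|_ [[[k q] r] [[/= Kk Dk] nO] <-]].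
      by exists ((k, q), r) => //; split => // -[_ /=]; exact.
    exists k; split => //.
    by apply: contrapT => kq; apply: nO.
  have cg (w : G * M * M) : (fun w : G * M * M => w.1.1) @ w --> w.1.1.
    by apply: (@cvg_comp _ _ _ fst fst); [exact: cvg_fst|exact: cvg_fst].
  have cq (w : G * M * M) : (fun w : G * M * M => w.1.2) @ w --> w.1.2.
    by apply: (@cvg_comp _ _ _ fst snd); [exact: cvg_fst|exact: cvg_snd].
  apply: sigma_compact_image.
    by move=> w; apply: cvg_pair; [exact: cq|exact: cvg_snd].
  apply: (@sigma_compact_locally_closed _ _ O1 O2) => //.
  - exact: lcsc_hausdorff_prod (lcsc_hausdorff_prod lcscG lcscM) lcscM.
  - rewrite openE => w [Kw Dw]; apply: filterI.
      have nK : nbhs w.1.1 K by apply: open_nbhs_nbhs; split.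
      exact: (cg w _ nK).
    exact: (near_ldom _ Dw (cg w) (cq w)).
  - rewrite openE => w [Dw kq]; apply: filterI.
      exact: (near_ldom _ Dw (cg w) (cq w)).
    have nN : nbhs (lact M w.1.1 w.1.2, w.2) [set x : M * M | x.1 <> x.2].
      apply: open_nbhs_nbhs; split; last exact: kq.
      by apply: open_offdiagonal; have [] := lcscM.
    have cr : (fun w : G * M * M => w.2) @ w --> w.2 by exact: cvg_snd.
    exact: (cvg_pair (cvg_lact _ Dw (cg w) (cq w)) cr nN).
pose Z : set (borel M * borel M) := Z0 `&` (good_points M U `*` setT).
have mZ : measurable Z by apply: measurableI => //; exact: measurableX.
pose P := nvol vol.
(* The section at a good point [q] is [K.q], of volume [m K]; all other sections are empty. *)
have xZ q : P (xsection Z q) = ((cst (m K * c)) \_ (good_points M U)) q.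
  rewrite patchE; case: ifPn => [|qU].
    rewrite inE => Uq.
    have -> : xsection Z q = (lact M)^~ q @` K.
      apply/seteqP; split=> r; rewrite /xsection /= inE.
        by move=> [[k [/= Kk _ kq]] _]; exists k.
      move=> [k Kk <-]; split => //; exists k; split => //=.
      by apply: (good_points_ldom Uq); exact: KU.
    rewrite /P nvolE//; congr (_ * _).
    exact: (good_points_vol volM oU U1 Uq (borel_open oK) KU).2.
  suff -> : xsection Z q = set0 by rewrite measure0.
  rewrite -subset0 => r; rewrite /xsection /= inE => -[_ [/= Uq _]].
  by move: qU; rewrite notin_setE.
(* Fix [q0] in the section, with [k0.q0 = r]. Any other [q] in it satisfies
   [q = k^-1.r = (k^-1 k0).q0], so the section lies in the chart at [q0], over [K^-1 k0], whose Haar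
   measure is that of [K^-1] by right invariance. *)
have yZ r : P (ysection Z r) <= m [set (k^-1)%g | k in K] * c.
  have [->|/set0P[q0]] := eqVneq (ysection Z r) set0.
    by rewrite measure0 mule_ge0.
  rewrite /ysection /= inE => -[[k0 [/= Kk0 Dk0 kq0]] [/= Uq0 _]].
  pose B := [set (x * k0)%g | x in [set (k^-1)%g | k in K]].
  have oB : open B by apply: open_mulr; exact: open_invg.
  have BU : B `<=` U by move=> _ [_ [k Kk <-] <-]; exact: KKU.
  have [mB vB] := good_points_vol volM oU U1 Uq0 (borel_open oB) BU.
  rewrite -(haar_mulr haarm k0); last by apply: borel_open; exact: open_invg.
  rewrite -/B -vB -nvolE//; apply: le_measure; rewrite ?inE//.
    exact: measurable_ysection.
  move=> q; rewrite /ysection /= inE => -[[k [/= Kk Dk kq]] _].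
  exists (k^-1 * k0)%g; first by exists (k^-1)%g => //; exists k.
  have [Dkr kr] := lactV Dk; rewrite kq -kq0 in Dkr kr.
  rewrite lactM// ?kr//; apply: (good_points_ldom Uq0); exact: KKU.
have FE : \int[P]_q P (xsection Z q) = \int[P]_r P (ysection Z r).
  have := indic_fubini_tonelli P P mZ.
  by rewrite indic_fubini_tonelli_FE// indic_fubini_tonelli_GE.
have le1 : m K * c * P (good_points M U) <= m [set (k^-1)%g | k in K] * c.
  rewrite -integral_cst// integral_mkcond.
  under eq_integral do rewrite -xZ.
  rewrite FE.
  pose C := m [set (k^-1)%g | k in K] * c.
  apply: (@le_trans _ _ (\int[P]_r (cst C r))).
    by apply: ge0_le_integral => //; exact: measurable_fun_ysection.
  rewrite integral_cst// [X in _ * X](@probability_setT _ _ _ P).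
  by rewrite mule1.
move: le1; rewrite muleAC lee_pmul2r// lte_fin invr_gt0.
by [].
Qed.

Variables (M : nat -> localGSpace G)
  (vol : forall i, {measure set (borel (M i)) -> \bar R}).
Hypotheses (volM : forall i, canonical_measure m (vol i))
  (soficM : sofic_approximation vol).

(** The sets [U i] of the sofic approximation increase to [G], so one of them contains a given
    compact set, and all later ones do as well; [eps i] eventually drops below [e]. *)
Lemma sofic_near (C : set G) (e : R) : precompact C -> (0 < e)%R ->
  \forall i \near \oo, exists U : set G,
    [/\ open U, precompact U, C `<=` U, U 1%g &
        0 < vol i [set: M i] < +oo /\
        (1 - e)%:E <= nvol (vol i) (good_points (M i) U)].
Proof.
move=> [D /= CD [cD _]] e0; have [U [eps [Uo Umon Ucov eps0 Usof]]] := soficM.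
have monU i j : (i <= j)%N -> U i `<=` U j.
  elim: j => [|j IH]; first by rewrite leqn0 => /eqP->.
  rewrite leq_eqVlt => /orP[/eqP->//|]; rewrite ltnS => /IH ij.
  exact: subset_trans ij (Umon j).
have [N DN] : exists N, D `<=` U N.
  move: cD; rewrite compact_cover => /(_ nat setT U).
  case=> [i _|x _|I _ DI]; first by have [] := Uo i.
    by rewrite /cover Ucov.
  exists (\max_(i <- finmap.enum_fset I) i)%N => x /DI[i iI Uix].
  by apply: monU Uix; exact: leq_bigmax_seq.
have [N1 _ U1] : (\bigcup_i U i) 1%g by rewrite Ucov.
near=> i; exists (U i); have [oU pU] := Uo i; split => //.
- apply: subset_trans CD (subset_trans DN (monU _ _ _)).
  by near: i; exact: nbhs_infty_ge.
- by apply: monU U1; near: i; exact: nbhs_infty_ge.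
have [volT le] := Usof i; split => //.
have v0 := fine_volT_gt0 volT.
rewrite nvolE// lee_pdivlMr//; apply: le_trans le.
move/andP: volT => [_ voo].
rewrite fineK ?ge0_fin_numE//; apply: lee_wpmul2r => //.
rewrite lee_fin lerD2l lerN2.
near: i; move/cvgr0_norm_le : eps0 => /(_ e e0).
by apply: filterS => i; apply: le_trans; exact: ler_norm.
Unshelve. all: by end_near. Qed.

(** Double counting loses only the proportion of points that are not good, and this proportion is
    made arbitrarily small by going far enough along the sofic approximation. *)
Lemma haar_le_inv (K : set G) : open K -> precompact K ->
  m K <= m [set (k^-1)%g | k in K].
Proof.
move=> oK pK; have [_ _ hG] := lcscG.
have mK := haar_precompact haarm (borel_open oK) pK.
have Kfin : m K \is a fin_num by rewrite ge0_fin_numE.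
have cinv : continuous (fun x : G => x^-1)%g by exact: invg_continuous.
(* [U] must contain [K] and [K^-1 K] for the double counting to stay inside charts. *)
pose C := K `|` [set (w.1^-1 * w.2)%g | w in K `*` K].
have pC : precompact C.
  have [D KD [cD clD]] := pK; rewrite /= in KD.
  have : precompact [set (w.1^-1 * w.2)%g | w in K `*` K].
    apply: precompact_image => //; last exact: precompact_setX.
    move=> w; apply: cvg_mulg; last exact: cvg_snd.
    by apply: (@cvg_comp _ _ _ fst (fun x : G => x^-1)%g); [exact: cvg_fst|exact: cinv].
  move=> [E KKE [cE clE]]; exists (D `|` E).
    by move=> x [/KD|/KKE] ?; [left|right].
  by split; [exact: compactU|exact: closedU].
apply/lee_addgt0Pr => e e0.
(* Chosen so that [m K * d <= e]; the added 1 keeps the denominator positive when [m K = 0]. *)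
pose d : R := (e / (fine (m K) + 1))%R.
have d0 : (0 < d)%R by rewrite divr_gt0// ltr_wpDl// fine_ge0.
have [i0 _ /(_ i0 (leqnn _))] := sofic_near pC d0.
move=> [U [oU pU CU U1 [volT leU]]].
have KU : K `<=` U by move=> k Kk; apply: CU; left.
have KKU k k' : K k -> K k' -> U (k^-1 * k')%g.
  by move=> Kk Kk'; apply: CU; right; exists (k, k').
have h : m K * (1 - d)%:E <= m [set (k^-1)%g | k in K].
  apply: le_trans (haar_le_inv_good_points (volM i0) volT oU U1 oK KU KKU).
  exact: lee_wpmul2l.
apply: le_trans (leeD2r e%:E h).
rewrite -(fineK Kfin) -EFinM -EFinD lee_fin mulrBr mulr1.
rewrite -addrA lerDl addrC subr_ge0 /d mulrA ler_pdivrMr; last first.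
  by rewrite ltr_wpDl// fine_ge0.
by rewrite mulrC; apply: ler_wpM2l; [exact: ltW|rewrite lerDl].
Qed.

(** For [W = g^-1 V'] with [V'] open and precompact, [haar_le_inv] and right invariance give [m W <=
    m (W^-1) = m (V'^-1 g) = m (V'^-1) <= m V']. Outer regularity passes from open sets to Borel
    sets, and intersecting with [U] ensures precompactness. *)
Lemma haar_le_mull (g : G) (F U : set G) :
  measurable (F : set (borel G)) -> open U -> precompact U ->
  [set (g * x)%g | x in F] `<=` U -> m F <= m [set (g * x)%g | x in F].
Proof.
move=> mF oU pU FU; have [_ _ hG] := lcscG.
have [[_ outer _] _ _] := haarm.
rewrite (outer [set (g * x)%g | x in F]); last exact: borel_mull.
apply: le_ereal_inf_tmp => _ [V [oV FV] <-].
pose V' := V `&` U; have oV' : open V' by exact: openI.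
have pV' : precompact V' by apply: precompact_subset pU; exact: subIsetr.
pose W := [set (g^-1 * x)%g | x in V'].
have oW : open W by exact: open_mull.
have pW : precompact W by apply: precompact_image => //; exact: mulgl_continuous.
have oI : open [set (x^-1)%g | x in V'] by exact: open_invg.
have pI : precompact [set (x^-1)%g | x in V'].
  by apply: precompact_image => //; exact: invg_continuous.
apply: (@le_trans _ _ (m W)).
  apply: le_measure; rewrite ?inE//; first exact: borel_open.
  move=> x Fx; exists (g * x)%g; last by rewrite mulKg.
  by split; [apply: FV|apply: FU]; exists x.
apply: (le_trans (haar_le_inv oW pW)).
have -> : [set (k^-1)%g | k in W] =
    [set (x * g)%g | x in [set (x^-1)%g | x in V']].
  apply/seteqP; split=> [_ [_ [x Vx <-] <-]|_ [_ [x Vx <-] <-]].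
    by exists (x^-1)%g; [exists x|rewrite invgM invgK].
  by exists (g^-1 * x)%g; [exists x|rewrite invgM invgK].
rewrite haar_mulr//; last exact: borel_open.
apply: (le_trans (haar_le_inv oI pI)).
have -> : [set (k^-1)%g | k in [set (x^-1)%g | x in V']] = V'.
  apply/seteqP; split=> [_ [_ [x Vx <-] <-]|x Vx]; first by rewrite invgK.
  by exists (x^-1)%g; [exists x|rewrite invgK].
by apply: le_measure; rewrite ?inE; [exact: borel_open|exact: borel_open|exact: subIsetl].
Qed.

End unimodularity.

(** * Volume of preimages *)

Section volume_of_preimages.
Context {R : realType} {G : topologicalGroupType}.
Variable m : {measure set (borel G) -> \bar R}.
Hypothesis lcscG : lcsc_hausdorff G.
Variables (M : localGSpace G) (vol : {measure set (borel M) -> \bar R}).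
Hypothesis volM : canonical_measure m vol.
Variable U : set G.
Hypotheses (oU : open U) (U1 : U 1%g).
(** The form in which unimodularity enters; [haar_le_mull] supplies it for precompact [U]. *)
Hypothesis le_mull : forall (g : G) (F : set G), measurable (F : set (borel G)) ->
  [set (g * x)%g | x in F] `<=` U -> (m F <= m [set (g * x)%g | x in F])%E.
Local Open Scope ereal_scope.

Lemma dom_at_open (g : G) : open (dom_at M g).
Proof.
rewrite openE => p Dp; have cid : id @ p --> p by exact: cvg_id.
exact: (near_ldom _ Dp (cvg_cst g) cid).
Qed.

Lemma lact_within_dom_at (g : G) : {within dom_at M g, continuous (lact M g)}.
Proof.
rewrite continuous_open_subspace; last exact: dom_at_open.
move=> p; rewrite inE => Dp; have cid : id @ p --> p by exact: cvg_id.
exact: (cvg_lact _ Dp (cvg_cst g) cid).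
Qed.

Lemma good_points_preimage_measurable (g : G) (S : set M) : U g ->
  measurable (S : set (borel M)) ->
  measurable (good_points M U `&` lact M g @^-1` S : set (borel M)).
Proof.
move=> Ug mS.
(* Outside of [dom_at M g] the values of [lact M g] are arbitrary, so the preimage is restricted to
   this open set, on which the map is continuous. *)
have -> : good_points M U `&` lact M g @^-1` S =
    good_points M U `&` (dom_at M g `&` lact M g @^-1` S).
  rewrite setIA; congr (_ `&` _); apply/esym/setIidl => p Up.
  exact: good_points_ldom Up Ug.
apply: measurableI; first exact: good_points_measurable.
apply: (borel_measurable_within (dom_at_open g) (@lact_within_dom_at g)) => //.
by apply: borel_open; exact: dom_at_open.
Qed.

(* In the chart at [p0] the map [p |-> g.p] is left translation by [g]. *)
Lemma vol_le_lact_chart (g : G) (p0 : M) (E : set M) : U g -> good_points M U p0 ->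
  measurable (E : set (borel M)) ->
  E `<=` (lact M)^~ p0 @` (U `&` [set w | U (g * w)%g]) ->
  measurable (lact M g @` E : set (borel M)) /\ vol E <= vol (lact M g @` E).
Proof.
move=> Ug Up0 mE EW.
pose B := U `&` (lact M)^~ p0 @^-1` E.
have mB : measurable (B : set (borel G)).
  exact: good_points_orbit_measurable.
have BU : B `<=` U by exact: subIsetl.
have gBU : [set (g * x)%g | x in B] `<=` U.
  move=> _ [w [Uw Ew] <-]; have [w' [Uw' Ugw']] := EW _ Ew.
  by move/(good_points_inj Up0); rewrite !inE => /(_ Uw' Uw) <-.
have EB : E = (lact M)^~ p0 @` B.
  apply/seteqP; split=> [p Ep|_ [w [_ Ew] <-]//].
  by have [w [Uw _] wp] := EW _ Ep; exists w => //; split => //=; rewrite wp.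
have gEB : lact M g @` E = (lact M)^~ p0 @` [set (g * x)%g | x in B].
  rewrite EB image_comp image_comp; apply: eq_imagel => w Bw /=.
  have Uw := BU _ Bw; have Ugw : U (g * w)%g by apply: gBU; exists w.
  by have [_ ->] := good_points_mul Up0 Ug Uw Ugw.
have [_ vE] := good_points_vol volM oU U1 Up0 mB BU.
have [mgE vgE] := good_points_vol volM oU U1 Up0 (borel_mull g mB) gBU.
by rewrite gEB; split => //; rewrite vgE EB vE; exact: le_mull.
Qed.

(** Countably many basic open sets, each inside one chart, cover the good points. Cut into disjoint
    pieces along them, the preimage is estimated piece by piece in charts; the images of the pieces
    lie in [S] and stay disjoint, since [g^-1] undoes [g]. *)
Lemma vol_preimage_le (g : G) (S : set M) : U g ->
  measurable (S : set (borel M)) ->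
  vol (good_points M U `&` lact M g @^-1` S) <= vol S.
Proof.
move=> Ug mS; have [_ /second_countable_seq[b [bo bn]] _] := lcarrier_lcsc M.
(* A neighbourhood of the identity, because [g] is in [U]; over it both [w] and [g w] remain in the
   chart. *)
pose Wg := U `&` [set w | U (g * w)%g].
have oWg : open Wg.
  apply: openI => //; apply: (@open_comp _ _ (fun w => (g * w)%g)) => //.
  by move=> w _; exact: mulgl_continuous.
pose good n := exists2 p0, good_points M U p0 & b n `<=` (lact M)^~ p0 @` Wg.
pose N n := if `[< good n >] then b n else set0.
pose Q := good_points M U `&` lact M g @^-1` S.
have mQ : measurable (Q : set (borel M)) by exact: good_points_preimage_measurable.
pose Qn n := Q `&` seqDU N n.
have mN n : measurable (N n : set (borel M)).
  by rewrite /N; case: asboolP => // _; exact: borel_open.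
have mQn n : measurable (Qn n : set (borel M)).
  by apply: measurableI => //; exact: seqDU_measurable.
have tQn : trivIset setT Qn by apply: trivIset_setIl; exact: trivIset_seqDU.
have QE : Q = \bigcup_n Qn n.
  rewrite -setI_bigcupr -seqDU_bigcup_eq; apply/esym/setIidl => p [Up _].
  have oW : open ((lact M)^~ p @` Wg).
    apply: orbit_map_open => // -[w q] [/= [Uw _] ->].
    exact: good_points_ldom Up Uw.
  have Wp : ((lact M)^~ p @` Wg) p.
    by exists 1%g; [split => //=; rewrite mulg1|exact: (lact1 p).2].
  have [n bp bW] := bn p _ (open_nbhs_nbhs (conj oW Wp)).
  by exists n => //; rewrite /N; case: asboolP => // -[]; exists p.
have piece n : measurable (lact M g @` Qn n : set (borel M)) /\
    vol (Qn n) <= vol (lact M g @` Qn n).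
  have := @subset_seqDU _ N n; rewrite {2}/N; case: asboolP => [|_ sN].
    move=> [p0 Up0 bW] sN; apply: (@vol_le_lact_chart _ p0) => //.
    by move=> p [_ /sN/bW].
  have -> : Qn n = set0 by rewrite -subset0 => p [_ /sN].
  by rewrite image_set0.
rewrite -/Q QE measure_semi_bigcup//; last exact: bigcup_measurable.
apply: (@le_trans _ _ (\sum_(i <oo) vol (lact M g @` Qn i))).
  by apply: lee_nneseries => // n _; exact: (piece n).2.
have mU : measurable (\bigcup_n (lact M g @` Qn n) : set (borel M)).
  by apply: bigcup_measurable => n _; exact: (piece n).1.
rewrite -measure_semi_bigcup//; last 2 first.
- by move=> n; exact: (piece n).1.
- move=> i j _ _ [_ [[p Qp <-] [q Qq qp]]]; apply: tQn => //; exists p.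
  suff pq : p = q by split => //; rewrite pq.
  have [[Up _] _] := Qp; have [[Uq _] _] := Qq.
  have [_ <-] := lactV (good_points_ldom Up Ug).
  by rewrite -qp; have [_ ->] := lactV (good_points_ldom Uq Ug).
apply: le_measure; rewrite ?inE// => _ [n _ [p [[_ Sp] _] <-]].
exact: Sp.
Qed.

End volume_of_preimages.

(** * Compact metric spaces *)

Section compatible_metrics.
Context {R : realType} {Y : ptopologicalType}.
Variable rho : Y -> Y -> R.
Hypothesis metric_rho : compatible_metric rho.

Lemma metric_ball_nbhs (x : Y) (e : R) : 0 < e -> nbhs x [set y | rho x y < e].
Proof. by have [_ _ _ _ h] := metric_rho => e0; apply/h; exists e; split. Qed.

Lemma metric_continuous : continuous (fun w : Y * Y => rho w.1 w.2).
Proof.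
have [_ _ rhoC rhoD _] := metric_rho.
move=> [x y]; apply/cvgrPdist_lt => /= e e0.
have e2 : 0 < e / 2 by rewrite divr_gt0.
exists ([set x' | rho x x' < e / 2], [set y' | rho y y' < e / 2]) => /=.
  by split; exact: metric_ball_nbhs.
move=> [x' y'] /= [xx' yy']; rewrite ltr_norml; apply/andP; split.
  have := rhoD x' x y'; have := rhoD x y y'; rewrite (rhoC x' x).
  move: xx' yy'; lra.
have := rhoD x x' y; have := rhoD x' y' y; rewrite (rhoC y' y).
move: xx' yy'; lra.
Qed.

(** The balls of radius [1/(n+1)] around finite nets, for all [n], form a countable base. *)
Lemma compact_metric_second_countable :
  compact [set: Y] -> @second_countable Y.
Proof.
have [_ rho0 rhoC rhoD rhoN] := metric_rho.
rewrite compact_cover => cY.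
have oB x e : open ([set y | rho x y < e]).
  rewrite openE => y xy; apply/rhoN; exists (e - rho x y).
  split; first by rewrite subr_gt0.
  move=> z /= yz; apply: le_lt_trans (rhoD x y z) _.
  by move: yz; rewrite ltrBrDl.
have fin n : exists2 C : set Y, countable C &
    [set: Y] `<=` \bigcup_(x in C) [set y | rho x y < n.+1%:R^-1].
  have [y _|y _|J _ cJ] := cY _ setT (fun x => [set y | rho x y < n.+1%:R^-1]).
  - exact: oB.
  - by exists y => //=; rewrite (rho0 y y).2// invr_gt0.
  - by eexists; [|exact: cJ]; exact/finite_set_countable/finite_fset.
pose c n := projT1 (cid2 (fin n)).
exists (\bigcup_n (fun x => [set y | rho x y < n.+1%:R^-1]) @` c n).
  apply: bigcup_countable => // n _; rewrite /c; case: cid2 => C cC _ /=.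
  exact: card_le_trans (card_image_le _ _) cC.
split; first by move=> _ [n _ [x _ <-]]; exact: oB.
move=> x V /rhoN[e [e0 eV]].
have e2 : 0 < e / 2 by rewrite divr_gt0.
have [n] := ltr_add_invr e2; rewrite add0r => ne.
have [z cz zx] : (\bigcup_(z in c n) [set y | rho z y < n.+1%:R^-1]) x.
  by rewrite /c; case: cid2 => C _ /= /(_ x I).
exists [set y | rho z y < n.+1%:R^-1]; first by split => //; exists n => //; exists z.
move=> y /= zy; apply: eV => /=; apply: le_lt_trans (rhoD x z y) _.
by rewrite (rhoC x z) (splitr e) ltrD//; [exact: lt_trans zx ne|exact: lt_trans zy ne].
Qed.

Lemma metric_measurable : @second_countable Y ->
  measurable_fun [set: borel Y * borel Y]
    (fun w : borel Y * borel Y => rho w.1 w.2).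
Proof.
move=> sY; apply: (measurability _ (measurable_realfun.RGenOpens.measurableE R)).
move=> _ [_ [x [y ->] <-]]; rewrite setTI; apply: borel_prod_open => //.
by move/continuousP: metric_continuous; apply; exact: interval_open.
Qed.

(** On the compact set [C] of triples [(h, (x, y))] with [h] in a compact set containing [L] and
    [rho x y >= eta], the continuous function [rho (h x) (h y)] never vanishes, since [h] acts
    injectively. Its image is closed and misses a ball around 0, whose radius is [c]. *)
Lemma action_uniform_inverse (G : topologicalGroupType) (a : G -> Y -> Y)
    (L : set G) (eta : R) :
  compact [set: Y] -> continuous_action a -> precompact L -> 0 < eta ->
  exists2 c : R, 0 < c &
    forall h x y, L h -> rho (a h x) (a h y) < c -> rho x y < eta.
Proof.
move=> cY [a1 aM ca] [K LK [cK _]] eta0; rewrite /= in LK.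
have [rho_ge0 rho0 rhoC rhoD rhoN] := metric_rho.
pose Phi (w : G * (Y * Y)) := rho (a w.1 w.2.1) (a w.1 w.2.2).
have cPhi : continuous Phi.
  move=> w.
  have cg : (fun w : G * (Y * Y) => w.1) @ w --> w.1 by exact: cvg_fst.
  have c1 : (fun w : G * (Y * Y) => w.2.1) @ w --> w.2.1.
    by apply: (@cvg_comp _ _ _ snd fst); [exact: cvg_snd|exact: cvg_fst].
  have c2 : (fun w : G * (Y * Y) => w.2.2) @ w --> w.2.2.
    by apply: (@cvg_comp _ _ _ snd snd); [exact: cvg_snd|exact: cvg_snd].
  have d1 : (fun w : G * (Y * Y) => a w.1 w.2.1) @ w --> a w.1 w.2.1.
    apply: (@cvg_comp _ _ _ (fun w => (w.1, w.2.1)) (fun x : G * Y => a x.1 x.2)).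
      exact: cvg_pair cg c1.
    exact: (ca (w.1, w.2.1)).
  have d2 : (fun w : G * (Y * Y) => a w.1 w.2.2) @ w --> a w.1 w.2.2.
    apply: (@cvg_comp _ _ _ (fun w => (w.1, w.2.2)) (fun x : G * Y => a x.1 x.2)).
      exact: cvg_pair cg c2.
    exact: (ca (w.1, w.2.2)).
  apply: (@cvg_comp _ _ _ (fun w : G * (Y * Y) => (a w.1 w.2.1, a w.1 w.2.2))
    (fun x : Y * Y => rho x.1 x.2) _
    (nbhs (a w.1 w.2.1, a w.1 w.2.2))); first exact: cvg_pair d1 d2.
  have h := @metric_continuous (a w.1 w.2.1, a w.1 w.2.2).
  exact: h.
pose C : set (G * (Y * Y)) := (K `*` setT) `&` [set w | eta <= rho w.2.1 w.2.2].
have cC : compact C.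
  apply: compact_closedI.
    apply: compact_setX => //; rewrite -setXTT; exact: compact_setX.
  apply: (@closed_comp _ _ (fun w : G * (Y * Y) => rho w.2.1 w.2.2)
    [set r | eta <= r]); last exact: closed_ge.
  move=> w _; have h := @metric_continuous w.2.
  apply: (@cvg_comp _ _ _ snd (fun x : Y * Y => rho x.1 x.2) _ (nbhs w.2)).
    exact: cvg_snd.
  exact: h.
have clPhi : closed (Phi @` C).
  apply: compact_closed; first exact: Rhausdorff.
  by apply: continuous_compact => //; exact: continuous_subspaceT.
have n0 : (~` (Phi @` C)) 0.
  move=> [[h [x y]] [_ /= exy] /rho0 hxy].
  have xy : x = y by rewrite -(a1 x) -(a1 y) -(mulVg h) !aM hxy.
  by move: exy; have /rho0 -> := xy; rewrite leNgt eta0.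
have : nbhs (0 : R) (~` (Phi @` C)).
  by apply: open_nbhs_nbhs; split => //; exact: closed_openC.
move=> /nbhs_ballP[c /= c0 cC0]; exists c => // h x y Lh hxy.
rewrite ltNge; apply/negP => exy.
have := cC0 (rho (a h x) (a h y)); apply.
  by rewrite /ball /= sub0r normrN ger0_norm.
by exists (h, (x, y)) => //; split => //; split => //=; exact: LK.
Qed.

End compatible_metrics.

(** * Displacement of a map *)

Section displacement.
Context {R : realType} {G : topologicalGroupType} {Y : ptopologicalType}.
Variables (a : G -> Y -> Y) (rho : Y -> Y -> R).
Hypotheses (lcscG : lcsc_hausdorff G) (compactY : compact [set: Y]).
Hypotheses (acta : continuous_action a) (metric_rho : compatible_metric rho).
Hypothesis rho_le1 : forall x y, rho x y <= 1.
Variables (M : localGSpace G) (vol : {measure set (borel M) -> \bar R}).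
Variable psi : {mfun borel M >-> borel Y}.

(* The integrand of [Delta], extended by 1 outside of the domain of the action. *)
Definition displacement (w : G * M) : R :=
  if w \in ldom M then rho (psi (lact M w.1 w.2)) (a w.1 (psi w.2)) else 1.

Lemma displacement_ge0 w : 0 <= displacement w.
Proof.
have [rho_ge0 _ _ _ _] := metric_rho.
by rewrite /displacement; case: ifP.
Qed.

Lemma displacement_le1 w : displacement w <= 1.
Proof. by rewrite /displacement; case: ifP. Qed.

Lemma displacement_measurable :
  measurable_fun [set: borel G * borel M] (displacement : borel G * borel M -> R).
Proof.
have sY := compact_metric_second_countable metric_rho compactY.
have [_ sG _] := lcscG; have [_ sM _] := lcarrier_lcsc M.
have [_ _ ca] := acta.
pose D : set (borel G * borel M) := ldom M.
have mD : measurable D by apply: borel_prod_open => //; exact: ldom_open.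
(* A total Borel extension of the action, equal to the second projection off [ldom M]; there the
   indicator of [D] later suppresses it. *)
pose act' (w : borel G * borel M) : borel M :=
  if w \in D then lact M w.1 w.2 else w.2.
have mact : measurable_fun [set: borel G * borel M] act'.
  apply: borel_measurable_fun => V oV; rewrite setTI.
  have -> : act' @^-1` V =
      (D `&` [set w | V (lact M w.1 w.2)]) `|` (~` D `&` snd @^-1` V).
    apply/seteqP; split=> w; rewrite /act' /=.
      case: ifPn => [/set_mem Dw Vw|/negP nDw Vw]; first by left.
      by right; split => // Dw; apply: nDw; exact: mem_set.
    by move=> [[Dw Vw]|[nDw Vw]]; [rewrite mem_set|rewrite memNset].
  apply: measurableU.
    apply: borel_prod_open => //; apply: open_within_preimage => //.
      exact: ldom_open.
    exact: lact_continuous.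
  apply: measurableI; first exact: measurableC.
  rewrite -[X in measurable X]setTI.
  by apply: (@measurable_snd _ _ (borel G) (borel M)) => //; exact: borel_open.
have ma : measurable_fun [set: borel G * borel Y]
    ((fun y => a y.1 y.2) : borel G * borel Y -> borel Y).
  apply: borel_measurable_fun => V oV; rewrite setTI; apply: borel_prod_open => //.
  by move/continuousP: ca; apply.
have mpsi : measurable_fun [set: borel M] psi by exact: measurable_funPT.
have mpsi1 : measurable_fun [set: borel G * borel M]
    ((fun w => psi (act' w)) : borel G * borel M -> borel Y).
  exact: measurableT_comp mpsi mact.
have mpsi2 : measurable_fun [set: borel G * borel M]
    ((fun w => (w.1, psi w.2)) : borel G * borel M -> borel G * borel Y).
  apply: measurable_fun_pair; first exact: measurable_fst.
  exact: measurableT_comp mpsi measurable_snd.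
have mapsi : measurable_fun [set: borel G * borel M]
    ((fun w => a w.1 (psi w.2)) : borel G * borel M -> borel Y).
  exact: measurableT_comp ma mpsi2.
have mH : measurable_fun [set: borel G * borel M]
    ((fun w => rho (psi (act' w)) (a w.1 (psi w.2))) : borel G * borel M -> R).
  apply: (@measurableT_comp _ _ _ _ _ _ (fun y : borel Y * borel Y => rho y.1 y.2)
    _ (fun w : borel G * borel M => (psi (act' w), a w.1 (psi w.2)))).
    exact: metric_measurable.
  exact: measurable_fun_pair mpsi1 mapsi.
have -> : displacement = (fun w => (\1_D w : R) *
    rho (psi (act' w)) (a w.1 (psi w.2)) + (\1_(~` D) w : R)).
  apply/funext => w; rewrite /displacement /act' !indicE in_setC.
  by case: ifPn => Dw; rewrite ?mul1r ?addr0// mul0r add0r.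
apply: measurable_funD.
  by apply: measurable_funM => //; exact: measurable_indic.
by apply: measurable_indic; exact: measurableC.
Qed.

Lemma displacement_measurable_at (g : G) :
  measurable_fun [set: borel M] (fun p : borel M => displacement (g, p)).
Proof.
exact: (@measurable_fun_pair2 _ _ _ (borel G) (borel M) _ displacement g
  displacement_measurable).
Qed.

Local Open Scope ereal_scope.

Lemma DeltaE (g : G) :
  Delta a rho vol g psi = \int[nvol vol]_p (displacement (g, p))%:E.
Proof.
have oD := dom_at_open M g.
have mD : measurable (dom_at M g : set (borel M)) by exact: borel_open.
rewrite /Delta -[in RHS](setUv (dom_at M g)) ge0_integral_setU//=; last 4 first.
- exact: measurableC.
- by apply/measurable_EFinP; rewrite setUv; exact: displacement_measurable_at.
- by move=> p _; rewrite lee_fin displacement_ge0.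
- by rewrite disj_set2E setICr.
congr (_ + _).
  by apply: eq_integral => p /set_mem Dp; rewrite /displacement mem_set.
rewrite -[LHS]mul1e -integral_cst//; last exact: measurableC.
by apply: eq_integral => p /set_mem Dp; rewrite /displacement memNset.
Qed.

(** By [DeltaE] this is a partial integral of a nonnegative jointly measurable function, so
    Tonelli's theorem applies. *)
Lemma Delta_measurable :
  measurable_fun [set: borel G] (fun g : borel G => Delta a rho vol g psi).
Proof.
rewrite (_ : (fun g => _) =
    fubini_F (nvol vol) (fun w : borel G * borel M => (displacement w)%:E)).
  apply: measurable_fun_fubini_tonelli_F => //=.
    by apply/measurable_EFinP; exact: displacement_measurable.
  by move=> w; rewrite lee_fin displacement_ge0.
by apply/funext => g; rewrite DeltaE.
Qed.

Lemma Delta_ge0 (g : G) : 0 <= Delta a rho vol g psi.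
Proof.
by rewrite DeltaE; apply: integral_ge0 => p _; rewrite lee_fin displacement_ge0.
Qed.

End displacement.

(** Markov's inequality, obtained from its version for absolute values. *)
Lemma markov_ge0 d (T : measurableType d) (R : realType)
    (mu : {measure set T -> \bar R}) (D : set T) (f : T -> \bar R) (c : R) :
  measurable D -> measurable_fun D f -> (forall x, D x -> (0 <= f x)%E) -> 0 < c ->
  (c%:E * mu (D `&` [set x | (c%:E <= f x)%E]) <= \int[mu]_(x in D) f x)%E.
Proof.
move=> mD mf f0 c0.
have := @le_integral_comp_abse _ _ _ mu D mD f c id (@measurable_id _ _ _).
move=> /(_ (fun _ => id) (fun _ _ _ _ => id) mf c0).
rewrite (_ : D `&` _ = D `&` [set x | (c%:E <= f x)%E]).
  move=> /le_trans; apply; rewrite le_eqVlt; apply/orP; left; apply/eqP.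
  by apply: eq_integral => x; rewrite inE => Dx; rewrite gee0_abs// f0.
by apply/seteqP; split=> x /= [Dx]; rewrite gee0_abs ?f0.
Qed.

(** * From average to pointwise displacement *)

Section average_displacement.
Context {R : realType} {G : topologicalGroupType} {Y : ptopologicalType}.
Variable m : {measure set (borel G) -> \bar R}.
Variables (a : G -> Y -> Y) (rho : Y -> Y -> R).
Hypotheses (lcscG : lcsc_hausdorff G) (haarm : right_haar m).
Hypothesis compactY : compact [set: Y].
Hypotheses (acta : continuous_action a) (metric_rho : compatible_metric rho).
Hypothesis rho_le1 : forall x y, rho x y <= 1.
Variables (M : localGSpace G) (vol : {measure set (borel M) -> \bar R}).
Hypotheses (volM : canonical_measure m vol) (volT : (0 < vol [set: M] < +oo)%E).
Variable U : set G.
Hypotheses (oU : open U) (U1 : U 1%g).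
Hypothesis le_mull : forall (g : G) (F : set G), measurable (F : set (borel G)) ->
  [set (g * x)%g | x in F] `<=` U -> (m F <= m [set (g * x)%g | x in F])%E.
Local Open Scope ereal_scope.

Lemma nvol_preimage_le (g : G) (S : set M) : U g ->
  measurable (S : set (borel M)) ->
  nvol vol (good_points M U `&` lact M g @^-1` S) <= nvol vol S.
Proof.
move=> Ug mS; rewrite !nvolE//; apply: lee_wpmul2r.
  by rewrite lee_fin invr_ge0 fine_ge0.
exact: (vol_preimage_le lcscG volM oU U1 le_mull Ug mS).
Qed.

Lemma Delta_markov (psi : {mfun borel M >-> borel Y}) (k : G) (c : R) : (0 < c)%R ->
  nvol vol [set p | (c <= displacement a rho psi (k, p))%R] <=
  Delta a rho vol k psi * c^-1%:E.
Proof.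
move=> c0; rewrite lee_pdivlMr// muleC DeltaE//.
have := @markov_ge0 _ (borel M) _ (nvol vol) setT
  (fun p => (displacement a rho psi (k, p))%:E) c measurableT.
rewrite setTI; apply => //.
  by apply/measurable_EFinP; exact: displacement_measurable_at.
by move=> p _; rewrite lee_fin displacement_ge0.
Qed.

(* Writes [g] as [h^-1 (h g)]: if [psi] nearly commutes with [h] and with [h g],
   then [h (psi (g.p))] is close to [h (g (psi p))], and [h] may be cancelled. *)
Lemma Delta_mul_le (psi : {mfun borel M >-> borel Y}) (g h : G) (c eta : R) :
  (0 < c)%R -> (0 < eta)%R -> U g -> U h -> U (h * g)%g ->
  (forall x y, rho (a h x) (a h y) < c + c -> rho x y < eta)%R ->
  Delta a rho vol g psi <= eta%:E + (nvol vol (~` good_points M U) +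
    (Delta a rho vol h psi * c^-1%:E + Delta a rho vol (h * g)%g psi * c^-1%:E)).
Proof.
move=> c0 eta0 Ug Uh Uhg heta.
have [rho_ge0 _ rhoC rhoD _] := metric_rho; have [a1 aM ca] := acta.
pose S k : set (borel M) := [set p | (c <= displacement a rho psi (k, p))%R].
have mS k : measurable (S k).
  rewrite /S -[X in measurable X]setTI.
  apply: (@measurable_fun_le _ _ _ setT (cst c)) => //.
  exact: displacement_measurable_at.
have mU : measurable (good_points M U : set (borel M)) by exact: good_points_measurable.
pose B1 : set (borel M) := ~` good_points M U.
pose B2 : set (borel M) := good_points M U `&` lact M g @^-1` S h.
(* Points that are not good, good points whose translate [g.p] is displaced by at least [c] under
   [h], and points so displaced under [h g]. The displacement under [g] is below [eta] off this set
   and at most 1 on it. *)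
pose bad : set (borel M) := B1 `|` (B2 `|` S (h * g)%g).
have mB1 : measurable B1 by exact: measurableC.
have mB2 : measurable B2 by exact: good_points_preimage_measurable.
have mbad : measurable bad by apply: measurableU => //; exact: measurableU.
have leB : nvol vol bad <= nvol vol B1 + (nvol vol B2 + nvol vol (S (h * g)%g)).
  apply: le_trans (measureU2 _ _ _) _ => //; first exact: measurableU.
  by apply: leeD2l; exact: measureU2.
have le1 : Delta a rho vol g psi <= eta%:E + nvol vol bad.
  rewrite DeltaE//.
  have -> : eta%:E + nvol vol bad =
      \int[nvol vol]_p (eta%:E + (\1_bad p)%:E).
    rewrite ge0_integralD//=.
    - rewrite integral_cst// integral_indic// setIT.
      by rewrite [X in _ * X](@probability_setT _ _ _ (nvol vol)) mule1.
    - by move=> p _; rewrite lee_fin ltW.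
    - by apply/measurable_EFinP; exact: measurable_indic.
  apply: ge0_le_integral => //=.
  - by move=> p _; rewrite lee_fin displacement_ge0.
  - by apply/measurable_EFinP; exact: displacement_measurable_at.
  - apply: emeasurable_funD => //.
    by apply/measurable_EFinP; exact: measurable_indic.
  move=> p _; rewrite -EFinD lee_fin indicE.
  have [_|] := boolP (p \in bad).
    by rewrite -[leLHS]add0r lerD ?displacement_le1// ltW.
  rewrite notin_setE => /not_orP[] /contrapT Up /not_orP[nB2 nS].
  rewrite addr0 /displacement mem_set /=; last exact: good_points_ldom Up Ug.
  apply/ltW/heta.
  have [Dhg hg] := good_points_mul Up Uh Ug Uhg.
  have : (displacement a rho psi (h, lact M g p) < c)%R.
    by rewrite ltNge; apply/negP => cS; apply: nB2.
  have : (displacement a rho psi ((h * g)%g, p) < c)%R.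
    by rewrite ltNge; apply/negP => cS; apply: nS.
  rewrite /displacement /= !mem_set//; last exact: good_points_ldom Up Uhg.
  rewrite -hg aM => l1 l2.
  (* The intermediate point is [psi (h.(g.p)) = psi ((h g).p)], within [c] of both [h (psi (g.p))]
     and [h (g (psi p))]. *)
  apply: le_lt_trans (rhoD _ (psi (lact M h (lact M g p))) _) _.
  by rewrite ltrD// rhoC.
apply: (le_trans le1); rewrite leeD2l//; apply: (le_trans leB).
rewrite leeD2l// leeD//; last exact: Delta_markov.
by apply: le_trans (nvol_preimage_le Ug (mS h)) _; exact: Delta_markov.
Qed.

(** The average over [L L] controls most elements, and for each [g] in [L] some [h] in [L] has both
    [h] and [h g] among them, so that [Delta_mul_le] applies. Passing to [L L] is what leaves room
    for [h g]. *)
Lemma Map_avg_subset (L : set G) (delta c : R) (O : set (weak_star R Y)) :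
  open L -> precompact L -> L 1%g -> (0 < delta)%R -> (0 < c)%R ->
  (forall h x y, L h -> rho (a h x) (a h y) < c + c -> rho x y < delta / 4)%R ->
  let LL := [set (w.1 * w.2)%g | w in L `*` L] in
  LL `<=` U -> open LL -> precompact LL ->
  (1 - delta / 4)%:E <= nvol vol (good_points M U) ->
  Map_avg m a rho vol LL (c * (delta / 8) * (fine (m L) / (2 * fine (m LL)))) O `<=`
  Map a rho vol L delta O.
Proof.
move=> oL pL L1 delta0 c0 hc LL LLU oLL pLL legood psi [avg Opsi]; split => // g Lg.
have LLL : L `<=` LL by move=> x Lx; exists (x, 1%g) => //=; rewrite mulg1.
have mL : measurable (L : set (borel G)) by exact: borel_open.
have mLL : measurable (LL : set (borel G)) by exact: borel_open.
have L0 : 0 < m L by apply: haar_open_gt0 => //; exists 1%g.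
have LL0 : 0 < m LL by apply: haar_open_gt0 => //; exists 1%g; exact: LLL.
have Loo := haar_precompact haarm mL pL; have LLoo := haar_precompact haarm mLL pLL.
have Lfin : m L \is a fin_num by rewrite ge0_fin_numE.
have LLfin : m LL \is a fin_num by rewrite ge0_fin_numE.
have l0 : (0 < fine (m L))%R by rewrite fine_gt0// L0.
have ll0 : (0 < fine (m LL))%R by rewrite fine_gt0// LL0.
(* The threshold for Markov's inequality: divided by [c] it leaves [delta / 8], and the factor
   [m L / (2 m LL)] in the bound on the average makes the exceptional set [B] smaller than
   [m L / 2]. *)
set c' := (c * (delta / 8))%R in avg.
have c'0 : (0 < c')%R by rewrite mulr_gt0// divr_gt0.
have mD : measurable_fun [set: borel G] (fun k : borel G => Delta a rho vol k psi).
  exact: Delta_measurable.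
pose B : set (borel G) := LL `&` [set k | c'%:E <= Delta a rho vol k psi].
have mB : measurable B.
  apply: emeasurable_fun_c_infty => //; exact: measurable_funS mD.
have Bfin : m B \is a fin_num.
  rewrite ge0_fin_numE//; apply: le_lt_trans LLoo.
  by apply: le_measure; rewrite ?inE//; exact: subIsetl.
have mBlt : (fine (m B) < fine (m L) / 2)%R.
  have : c'%:E * m B < (c' * (fine (m L) / 2))%:E.
    apply: le_lt_trans (markov_ge0 m _ _ _ c'0) _ => //.
    - exact: measurable_funS mD.
    - by move=> k _; exact: Delta_ge0.
    move: avg; rewrite muleC lte_pdivrMr// -EFinM; congr (_ < _%:E).
    by field; rewrite gt_eqF.
  by rewrite -(fineK Bfin) -EFinM lte_fin ltr_pM2l.
have [h [Lh Dh Dhg]] : exists h, [/\ L h, Delta a rho vol h psi < c'%:E &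
    Delta a rho vol (h * g)%g psi < c'%:E].
  (* Otherwise [L] is covered by [B] and [B g^-1], which have equal measure by right invariance, and
     so [m L] is less than itself. *)
  apply: contrapT => nh.
  pose Bg := [set (x * g^-1)%g | x in (B : set G)].
  have mBg : measurable (Bg : set (borel G)).
    apply: (@borel_image_can _ _ _ (fun x => x * g)%g) => //.
    - by move=> x; rewrite mulgVK.
    - by move=> x; rewrite mulgK.
    - exact: mulgr_continuous.
  have : m L <= m B + m B.
    rewrite -{2}(haar_mulr haarm (g^-1)%g mB).
    apply: le_trans (measureU2 m mB mBg).
    apply: le_measure; rewrite ?inE//; first exact: measurableU.
    move=> h Lh; have [Dh|Dh] := leP c'%:E (Delta a rho vol h psi).
      by left; split => //; exact: LLL.
    right; exists (h * g)%g; last by rewrite mulgK.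
    split; first by exists (h, g).
    by rewrite /= leNgt; apply/negP => Dhg; apply: nh; exists h.
  rewrite -(fineK Bfin) -(fineK Lfin) -EFinD lee_fin leNgt => /negP; apply.
  by rewrite [ltRHS]splitr ltrD.
have Uh : U h by exact/LLU/LLL.
have Ug : U g by exact/LLU/LLL.
have Uhg : U (h * g)%g by apply: LLU; exists (h, g).
have d40 : (0 < delta / 4)%R by rewrite divr_gt0.
apply: le_lt_trans (Delta_mul_le psi c0 d40 Ug Uh Uhg _) _.
  by move=> x y; exact: hc.
have gle : nvol vol (~` good_points M U) <= (delta / 4)%:E.
  rewrite probability_setC//; last exact: good_points_measurable.
  have Pfin : nvol vol (good_points M U) \is a fin_num.
    by apply: fin_num_measure; exact: good_points_measurable.
  move: legood; rewrite -(fineK Pfin) -EFinB !lee_fin; lra.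
have cE : (c' * c^-1 = delta / 8)%R by rewrite /c' mulrC mulKf// gt_eqF.
have kle k : Delta a rho vol k psi < c'%:E ->
    Delta a rho vol k psi * c^-1%:E <= (delta / 8)%:E.
  move=> Dk; rewrite -cE EFinM; apply: lee_wpmul2r; last exact: ltW.
  by rewrite lee_fin invr_ge0 ltW.
(* The four error terms add up to [3 delta / 4]. *)
apply: (@le_lt_trans _ _ ((delta / 4)%:E + ((delta / 4)%:E +
    ((delta / 8)%:E + (delta / 8)%:E)))).
  by rewrite leeD2l// leeD// leeD//; exact: kle.
by rewrite -!EFinD lte_fin; lra.
Qed.

End average_displacement.

(** * Comparison of the entropies *)

Lemma Sep_ge0 (R : realType) (T : Type) (eps : R) (E : set T) (d : T -> T -> \bar R) :
  (0 <= Sep eps E d)%E.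
Proof.
apply: ereal_sup_ubound; exists 0%N => //; exists set0; split=> //.
by rewrite II0.
Qed.

Lemma le_Sep (R : realType) (T : Type) (eps : R) (E F : set T)
    (d : T -> T -> \bar R) : E `<=` F -> (Sep eps E d <= Sep eps F d)%E.
Proof.
move=> EF; apply: le_ereal_sup => _ [n [A [AE cA sA]] <-].
by exists n => //; exists A; split=> //; exact: subset_trans EF.
Qed.

(** The upper limit is an infimum of suprema over members of the filter, and each member may be
    shrunk to the indices at which the inequality holds. *)
Lemma le_limn_esup (R : realType) (u v : (\bar R)^nat) :
  (\forall i \near \oo, (u i <= v i)%E) -> (limn_esup u <= limn_esup v)%E.
Proof.
move=> uv; apply: le_ereal_inf_tmp => _ [A FA <-].
pose B := A `&` [set i | (u i <= v i)%E].
apply: (@le_trans _ _ (ereal_sup (u @` B))).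
  by apply: ereal_inf_lbound; exists B => //; exact: filterI.
apply: ge_ereal_sup => _ [i [Ai uvi] <-].
by apply: (le_trans uvi); apply: ereal_sup_ubound; exists i.
Qed.

Section comparison.
Context {R : realType} {G : topologicalGroupType} {Y : ptopologicalType}.
Variable m : {measure set (borel G) -> \bar R}.
Variables (a : G -> Y -> Y) (rho : Y -> Y -> R).
Hypotheses (lcscG : lcsc_hausdorff G) (haarm : right_haar m).
Hypothesis compactY : compact [set: Y].
Hypotheses (acta : continuous_action a) (metric_rho : compatible_metric rho).
Hypothesis rho_le1 : forall x y, rho x y <= 1.

(** Averaging the pointwise bounds is done with a weak inequality; starting from [delta / 2] makes
    the final one strict. *)
Lemma Map_subset_avg (M : localGSpace G) (vol : {measure set (borel M) -> \bar R})
    (L : set G) (delta : R) (O : set (weak_star R Y)) :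
  unit_nbhs L -> 0 < delta ->
  Map a rho vol L (delta / 2) O `<=` Map_avg m a rho vol L delta O.
Proof.
move=> [[oL L1] pL] delta0 psi [small Opsi]; split => //.
have mL : measurable (L : set (borel G)) by exact: borel_open.
have L0 : (0 < m L)%E by apply: haar_open_gt0 => //; exists 1%g.
have Loo := haar_precompact haarm mL pL.
have Lfin : m L \is a fin_num by rewrite ge0_fin_numE.
have l0 : (0 < fine (m L))%R by rewrite fine_gt0// L0.
rewrite muleC lte_pdivrMr//.
apply: (@le_lt_trans _ _ (\int[m]_(g in L) (cst (delta / 2)%:E g))%E).
  apply: ge0_le_integral => //.
  - by move=> g _; exact: Delta_ge0.
  - apply: measurable_funS (_ : measurable_fun setT _) => //.
    exact: Delta_measurable.
  - by move=> g Lg; exact/ltW/small.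
rewrite integral_cst// -(fineK Lfin) -!EFinM lte_fin ltr_pM2r//.
by rewrite ltr_pdivrMr// mulr_natr mulr2n ltrDl.
Qed.

Variables (M : nat -> localGSpace G)
  (vol : forall i, {measure set (borel (M i)) -> \bar R}).
Hypotheses (volM : forall i, canonical_measure m (vol i))
  (soficM : sofic_approximation vol).

(** [L'] and [delta'] are chosen before [O] and the index [i], as the comparison of infima demands;
    the sofic approximation only affects how large [i] has to be. *)
Lemma Map_avg_subset_near (L : set G) (delta : R) :
  unit_nbhs L -> 0 < delta ->
  exists (L' : set G) (delta' : R), [/\ unit_nbhs L', 0 < delta' &
    forall O : set (weak_star R Y), \forall i \near \oo,
      Map_avg m a rho (vol i) L' delta' O `<=` Map a rho (vol i) L delta O].
Proof.
move=> [[oL L1] pL] delta0; have [_ _ hG] := lcscG.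
have d40 : 0 < delta / 4 by rewrite divr_gt0.
have [c2 c20 hc] := action_uniform_inverse metric_rho compactY acta pL d40.
(* Half of the modulus, since two errors of size [c] are added before [h] is cancelled. *)
pose c := c2 / 2; have c0 : 0 < c by rewrite divr_gt0.
have cc : c + c = c2 by rewrite -splitr.
pose LL := [set (w.1 * w.2)%g | w in L `*` L].
have LL1 : LL 1%g by exists (1%g, 1%g) => //=; rewrite mulg1.
have oLL : open LL.
  have -> : LL = \bigcup_(h in L) [set (x * h)%g | x in L].
    apply/seteqP; split=> [_ [[x h] [/= Lx Lh] <-]|_ [h Lh [x Lx <-]]].
      by exists h => //; exists x.
    by exists (x, h).
  by apply: bigcup_open => h _; exact: open_mulr.
have pLL : precompact LL.
  apply: precompact_image => //; last exact: precompact_setX.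
  exact: mulg_continuous.
exists LL, (c * (delta / 8) * (fine (m L) / (2 * fine (m LL)))); split.
- by split.
- have pos (K : set G) : open K -> K 1%g -> precompact K -> 0 < fine (m K).
    move=> oK K1 pK; rewrite fine_gt0// (haar_open_gt0 lcscG haarm oK)/=; last by exists 1%g.
    exact: (haar_precompact haarm (borel_open oK) pK).
  have lL := pos L oL L1 pL; have lLL := pos LL oLL LL1 pLL.
  apply: mulr_gt0; first by apply: mulr_gt0 => //; rewrite divr_gt0.
  by apply: divr_gt0 => //; rewrite mulr_gt0.
move=> O; have := sofic_near soficM pLL d40; apply: filterS => i.
move=> [U [oU pU LLU U1 [volT legood]]].
apply: (Map_avg_subset lcscG haarm compactY acta metric_rho rho_le1
  (volM i) volT oU U1) => //.
- by move=> g F mF gFU; exact: (haar_le_mull lcscG haarm volM soficM mF oU pU gFU).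
- by move=> h x y; rewrite cc; exact: hc.
Qed.

Variable nu : probability (borel Y) R.
Local Open Scope ereal_scope.

Lemma le_log_Sep (i : nat) (eps : R) (E F : set {mfun borel (M i) >-> borel Y}) :
  E `<=` F ->
  ((fine (vol i [set: M i]))^-1)%:E * lne (Sep eps E (rhoM rho (vol i))) <=
  ((fine (vol i [set: M i]))^-1)%:E * lne (Sep eps F (rhoM rho (vol i))).
Proof.
move=> EF; apply: lee_wpmul2l; first by rewrite lee_fin invr_ge0 fine_ge0.
by rewrite lee_lne ?in_itv/= ?leey ?Sep_ge0//; exact: le_Sep.
Qed.

(** Each choice of parameters on one side is matched by a choice on the other with the same
    weak-star neighbourhood and no larger upper limit. An inclusion between the sets of maps for all
    large [i] is enough for this. *)
Lemma h_meas_avg_epsE (eps : R) :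
  h_meas_avg_eps m a rho vol nu eps = h_meas_eps a rho vol nu eps.
Proof.
apply/eqP; rewrite eq_le; apply/andP; split.
  apply: le_ereal_inf_tmp => _ [V nV <-].
  apply: le_ereal_inf_tmp => _ [L uL <-].
  apply: le_ereal_inf_tmp => _ [delta /= delta0 <-].
  have [L' [delta' [uL' delta'0 sub]]] := Map_avg_subset_near uL delta0.
  apply: (le_trans (ereal_inf_lbound _)); first by exists V.
  apply: (le_trans (ereal_inf_lbound _)); first by exists L'.
  apply: (le_trans (ereal_inf_lbound _)); first by exists delta'.
  apply: le_limn_esup; have := sub V; apply: filterS => i; exact: le_log_Sep.
apply: le_ereal_inf_tmp => _ [V nV <-].
apply: le_ereal_inf_tmp => _ [L uL <-].
apply: le_ereal_inf_tmp => _ [delta /= delta0 <-].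
apply: (le_trans (ereal_inf_lbound _)); first by exists V.
apply: (le_trans (ereal_inf_lbound _)); first by exists L.
apply: (le_trans (ereal_inf_lbound _)).
  by exists (delta / 2)%R => //=; rewrite divr_gt0.
apply: le_limn_esup; apply: nearW => i; apply: le_log_Sep.
exact: Map_subset_avg.
Qed.

End comparison.

Theorem proposition2p15 (R : realType) (G : topologicalGroupType)
  (lcscG : lcsc_hausdorff G)
  (m : {measure set (borel G) -> \bar R}) (haarm : right_haar m)
  (M : nat -> localGSpace G)
  (vol : forall i, {measure set (borel (M i)) -> \bar R})
  (volM : forall i, canonical_measure m (vol i))
  (soficM : sofic_approximation vol)
  (Y : ptopologicalType) (compactY : compact [set: Y])
  (a : G -> Y -> Y) (acta : continuous_action a)
  (nu : probability (borel Y) R) (nu_inv : invariant_measure a nu)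
  (rho : Y -> Y -> R) (metric_rho : compatible_metric rho)
  (rho_le1 : forall x y, rho x y <= 1) :
  (forall eps : R, 0 < eps ->
     h_meas_avg_eps m a rho vol nu eps = h_meas_eps a rho vol nu eps) /\
  h_meas_avg m a rho vol nu = h_meas a rho vol nu.
Proof.
(* Equality as functions of [eps], so that both limits are limits of the same function. *)
have hE : h_meas_avg_eps m a rho vol nu = h_meas_eps a rho vol nu.
  by apply/funext => eps; exact: h_meas_avg_epsE.
by split=> [eps _|]; rewrite ?/h_meas_avg hE.
Qed.
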